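(* As $|v|\to\infty$, $$\lambda_1(|v|)\sim2\pi\,\frac{\log(2+|v|)}{1+|v|^3},\qquad\lambda_2(|v|)\sim\sqrt{\frac\pi8}\;\frac{\int_0^\infty e^{-\frac12y^2}J(y)\,dy}{1+|v|},$$ where $\sim$ means that the ratio of the two sides tends to $1$. Moreover, there are positive constants $C^1,C^2$ such that for any multi-index $\beta$ with $|\beta|\le1$ and all $v\in\mathbb{R}^3$, $$\left|D^\beta\lambda_1(|v|)\right|\le C^1\log(2+|v|)\,(1+|v|)^{-3-|\beta|},\qquad\left|D^\beta\lambda_2(|v|)\right|\le C^2(2+|v|)^{-1-|\beta|},$$ where $D^\beta$ denotes differentiation in $v$.
   Context: Fix $0<k_0<\infty$. Define $\Psi_R(x)=1-xe^{-x^2/2}\int_0^xe^{y^2/2}dy$, $\Psi_I(x)=-\sqrt{\pi/2}\,xe^{-x^2/2}$ and $\epsilon(\rho,x)=1+\rho^{-2}(\Psi_R(x)+i\Psi_I(x))$ for $\rho>0$, $x\in\mathbb{R}$. Define $$J(x)=4\int_0^{k_0}\frac{d\rho}{\rho\,|\epsilon(\rho,x)|^2}=\int_0^{k_0}\frac{4\rho^3}{\{\rho^2+\Psi_R(x)\}^2+\Psi_I^2(x)}d\rho .$$ The functions $\lambda_1,\lambda_2$ (the eigenvalues of the linearized Balescu-Lenard collision frequency matrix) are $$\lambda_1(|v|)=(2\pi)^{-1/2}\int_{|k|\le k_0}\frac{k_1^2}{|k|^5}\frac{e^{-\frac12(|v|k_1/|k|)^2}}{|\epsilon(|k|,k_1|v|/|k|)|^2}dk,$$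 $$\lambda_2(|v|)=(2\pi)^{-1/2}\int_{|k|\le k_0}\frac{k_2^2+k_3^2}{2|k|^5}\frac{e^{-\frac12(|v|k_1/|k|)^2}}{|\epsilon(|k|,k_1|v|/|k|)|^2}dk,$$ where $k=(k_1,k_2,k_3)\in\mathbb{R}^3$. *)

(* Defs.v *)
(* MathComp-Analysis, over an arbitrary R : realType. *)
From HB Require Import structures.
From mathcomp Require Import all_boot all_order all_algebra.
From mathcomp Require Import complex.
From mathcomp Require Import all_classical all_reals all_analysis.

Set Implicit Arguments.
Unset Strict Implicit.
Unset Printing Implicit Defensive.

Import Order.TTheory GRing.Theory Num.Theory.
Import numFieldNormedType.Exports.
Import ComplexField.Normc.

Local Open Scope classical_set_scope.
Local Open Scope ring_scope.

Section Calculus.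
Context {R : realType}.

Let mu : {measure set (measurableTypeR R) -> \bar R} := lebesgue_measure.

(* Oriented: for b < a this is minus the integral over [b, a]. *)
Definition oriented_integral (a b : R) (f : R -> R) : R :=
  if a <= b then \int[mu]_(t in `[a, b]) f t
  else - (\int[mu]_(t in `[b, a]) f t).

(* The norm that the library puts on 'rV[R]_3 is the sup norm. *)
Definition euclidean_norm (v : 'rV[R]_3) : R :=
  Num.sqrt (\sum_(i < 3) v 0 i ^+ 2).

(* Row vectors carry no measurable structure in the library, so that integrals
   over R^3 are transported from R * R * R with its product Lebesgue measure. *)
Definition vec3 (k : R * R * R) : 'rV[R]_3 :=
  \row_(i < 3) [:: k.1.1; k.1.2; k.2]`_i.

Definition integral3 (D : set 'rV[R]_3) (f : 'rV[R]_3 -> R) : R :=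
  \int[((lebesgue_measure \x lebesgue_measure) \x lebesgue_measure)%E]_(k in
     vec3 @^-1` D) f (vec3 k).

Definition partial (i : 'I_3) (f : 'rV[R]_3 -> R) : 'rV[R]_3 -> R :=
  'D_(delta_mx 0 i) f.

Definition mdegree (beta : 'I_3 -> nat) : nat := (\sum_(i < 3) beta i)%N.

Definition multi_derive (beta : 'I_3 -> nat) (f : 'rV[R]_3 -> R) :
    'rV[R]_3 -> R :=
  foldr (fun i g => iter (beta i) (partial i) g) f (enum 'I_3).

Definition asymp_equiv (f g : R -> R) : Prop :=
  f r / g r @[r --> +oo] --> (1 : R).

End Calculus.

Section BalescuLenard.
Context {R : realType}.

Let mu : {measure set (measurableTypeR R) -> \bar R} := lebesgue_measure.

Definition PsiR (x : R) : R :=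
  1 - x * expR (- (x ^+ 2 / 2)) *
      oriented_integral 0 x (fun y => expR (y ^+ 2 / 2)).

Definition PsiI (x : R) : R :=
  - (Num.sqrt (pi / 2) * x * expR (- (x ^+ 2 / 2))).

(* Meaningful for 0 < rho only. *)
Definition epsilon (rho x : R) : R[i] :=
  (1 + (rho ^- 2)%:C * (PsiR x +i* PsiI x))%C.

Definition J (k0 x : R) : R :=
  4 * \int[mu]_(rho in `]0, k0]) (rho * normc (epsilon rho x) ^+ 2)^-1.

(* The part of the integrands common to both eigenvalues, at |v| = r. The
   point k = 0, where it is not meaningful, has measure zero. *)
Definition kernel (r : R) (k : 'rV[R]_3) : R :=
  let u := k 0 0 / euclidean_norm k in
  expR (- ((r * u) ^+ 2 / 2)) / normc (epsilon (euclidean_norm k) (r * u)) ^+ 2.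

Definition lambda1 (k0 r : R) : R :=
  (Num.sqrt (2 * pi))^-1 *
  integral3 [set k | euclidean_norm k <= k0]
    (fun k => k 0 0 ^+ 2 / euclidean_norm k ^+ 5 * kernel r k).

Definition lambda2 (k0 r : R) : R :=
  (Num.sqrt (2 * pi))^-1 *
  integral3 [set k | euclidean_norm k <= k0]
    (fun k => (k 0 1 ^+ 2 + k 0 2 ^+ 2) / (2 * euclidean_norm k ^+ 5)
              * kernel r k).

End BalescuLenard.

(* Main.v *)
Require Import Defs.
From HB Require Import structures.
From mathcomp Require Import all_boot all_order all_algebra.
From mathcomp Require Import complex ring lra.
From mathcomp Require Import all_classical all_reals all_analysis.
From mathcomp Require Import measurable_realfun.

Set Implicit Arguments.
Unset Strict Implicit.
Unset Printing Implicit Defensive.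

Import Order.TTheory GRing.Theory Num.Theory.
Import numFieldNormedType.Exports.

Local Open Scope classical_set_scope.
Local Open Scope ring_scope.

(** Let K be the square of k0, let
    D(s,x) = (s + PsiR x)^2 + (PsiI x)^2, which is rho^4 |epsilon(rho,x)|^2 at
    s = rho^2, and let g(x) = exp(-x^2/2) J(x), where
    J(x) = 2 int_0^K s / D(s,x) ds.

    _Reduction to one variable._  Both integrands depend on k only through |k|
    and the coordinate k_1.  In spherical coordinates around the first axis,
    with u = k_1/|k|, the radial integral is J(r u) up to a constant, and with
      N_n(r) = int_0^1 u^n g(r u) du = r^(-n-1) int_0^r x^n g(x) dx
    the eigenvalues are multiples of N_2 and of (N_0 - N_2)/2
    ([lambda1_moment], [lambda2_moment]).  The coordinates come from
    [integral_axially_symmetric], that is from the area of a disc being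
    proportional to its squared radius.

    _Three properties of g_ carry everything else: g is continuous
    ([continuous_gauss_J]); |g(x) - g(0)| = O(x^2) at 0 ([gauss_J_quadratic]),
    because PsiR - 1 and PsiI^2 are quadratic there; and x^3 g(x) tends to
    L = 2 sqrt(2 pi) at infinity ([cvg_cube_gauss_J]).  The last one is a
    resonance.  For large x, PsiR x is close to -1/x^2 while |PsiI x| is
    of order x exp(-x^2/2), so that s / D(s,x) has a very narrow Lorentz peak
    at s = -PsiR x of mass pi |PsiR x| / |PsiI x|; the factor exp(-x^2/2) of g
    cancels the exponential in PsiI.  The elementary primitive of s / D(s,x)
    ([J_closed_form]) turns this into the limits of two arctangents, and the
    behaviour of PsiR ([cvg_sq_PsiR]) comes from explicit sub- and
    supersolutions for its defining integral.

    _Consequences._  As x^2 g(x) behaves like L/x, int_0^r x^2 g grows like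
    L log r ([cvg_primitive2_ln]), whereas g itself is integrable on the half
    line ([cvg_primitive0]); this gives the two equivalents and the bounds of
    order zero.  Differentiating r^(-n-1) int_0^r x^n g yields
    N_n'(r) = (g(r) - (n+1) N_n(r)) / r ([is_derive_moment]), so that no
    derivative of J is involved and the same bounds control the gradient away
    from 0.  Near 0 the numerator is O(r^2), since (n+1) N_n(0) = g(0), and at
    the origin itself N_n(r) - N_n(0) = O(r^2) makes the radial function
    differentiable with zero gradient ([is_derive_radial0]). *)

(** * Derivatives of expressions in one real variable *)

Section PointwiseDerivatives.
Context {R : realType}.
Implicit Types (f g : R -> R) (x : R).

Lemma is_derive_fun_cst (c x : R) : is_derive x 1 (fun _ : R => c) 0.
Proof. exact: is_derive_cst. Qed.

Lemma is_derive_fun_id x : is_derive x 1 (fun y : R => y) 1.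
Proof. exact: is_derive_id. Qed.

Lemma is_derive_fun_add f g x (df dg : R) :
  is_derive x 1 f df -> is_derive x 1 g dg ->
  is_derive x 1 (fun y => f y + g y) (df + dg).
Proof. by move=> hf hg; exact: is_deriveD. Qed.

Lemma is_derive_fun_opp f x (df : R) :
  is_derive x 1 f df -> is_derive x 1 (fun y => - f y) (- df).
Proof. by move=> hf; exact: is_deriveN. Qed.

Lemma is_derive_fun_mul f g x (df dg : R) :
  is_derive x 1 f df -> is_derive x 1 g dg ->
  is_derive x 1 (fun y => f y * g y) (f x * dg + g x * df).
Proof. by move=> hf hg; exact: is_deriveM. Qed.

Lemma is_derive_fun_exp f x (df : R) n :
  is_derive x 1 f df ->
  is_derive x 1 (fun y => f y ^+ n) (n%:R * f x ^+ n.-1 * df).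
Proof.
move=> hf; rewrite (_ : (fun _ => _) = (f ^+ n : R -> R)); last first.
  by apply/funext => y; rewrite fctE.
exact: is_deriveX.
Qed.

Lemma is_derive_fun_inv f x (df : R) : f x != 0 ->
  is_derive x 1 f df ->
  is_derive x 1 (fun y => (f y)^-1) (- f x ^- 2 * df).
Proof. by move=> fx0 hf; exact: is_deriveV. Qed.

Lemma is_derive_fun_comp h f x (dh df : R) :
  is_derive (f x) 1 h dh -> is_derive x 1 f df ->
  is_derive x 1 (fun y => h (f y)) (dh * df).
Proof. by move=> hh hf; exact: is_derive1_comp hh hf. Qed.

Lemma is_derive_fun_expR f x (df : R) :
  is_derive x 1 f df -> is_derive x 1 (fun y => expR (f y)) (expR (f x) * df).
Proof. exact: is_derive_fun_comp. Qed.

Lemma is_derive_fun_ln f x (df : R) : 0 < f x ->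
  is_derive x 1 f df -> is_derive x 1 (fun y => ln (f y)) ((f x)^-1 * df).
Proof. by move=> fx; apply: is_derive_fun_comp; exact: is_derive1_ln. Qed.

Lemma is_derive_fun_atan f x (df : R) :
  is_derive x 1 f df ->
  is_derive x 1 (fun y => atan (f y)) ((1 + f x ^+ 2)^-1 * df).
Proof. by apply: is_derive_fun_comp; exact: is_derive1_atan. Qed.

Lemma is_derive_fun_sqrt f x (df : R) : 0 < f x ->
  is_derive x 1 f df ->
  is_derive x 1 (fun y => Num.sqrt (f y)) ((2 * Num.sqrt (f x))^-1 * df).
Proof. by move=> fx; apply: is_derive_fun_comp; exact: is_derive1_sqrt. Qed.

End PointwiseDerivatives.

Lemma is_derive_val {R : realType} (f : R -> R) (x a b : R) :
  is_derive x 1 f a -> a = b -> is_derive x 1 f b.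
Proof. by move=> h <-. Qed.

(** Reads a derivative off the syntax of the function. Type class resolution is
    kept for the leaves: the generic instances would express the derivative of
    a product through scaling, which [ring] does not see through. *)
Ltac pointwise_derive :=
  lazymatch goal with
  | |- is_derive _ _ (fun _ => ?c) _ =>
      notypeclasses refine (is_derive_fun_cst _ _)
  | |- is_derive _ _ (fun y => y) _ =>
      notypeclasses refine (is_derive_fun_id _)
  | |- is_derive _ _ (fun y => (_ + _)%R) _ =>
      notypeclasses refine (is_derive_fun_add _ _); pointwise_derive
  | |- is_derive _ _ (fun y => (- _)%R) _ =>
      notypeclasses refine (is_derive_fun_opp _); pointwise_derive
  | |- is_derive _ _ (fun y => (_ * _)%R) _ =>
      notypeclasses refine (is_derive_fun_mul _ _); pointwise_derive
  | |- is_derive _ _ (fun y => (_ ^+ _)%R) _ =>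
      notypeclasses refine (is_derive_fun_exp _ _); pointwise_derive
  | |- is_derive _ _ (@GRing.inv _) _ =>
      notypeclasses refine (@is_derive_fun_inv _ (fun y => y) _ _ _ (is_derive_fun_id _))
  | |- is_derive _ _ (fun y => (_ ^-1)%R) _ =>
      notypeclasses refine (is_derive_fun_inv _ _); [|pointwise_derive]
  | |- is_derive _ _ (fun y => expR _) _ =>
      notypeclasses refine (is_derive_fun_expR _); pointwise_derive
  | |- is_derive _ _ (fun y => ln _) _ =>
      notypeclasses refine (is_derive_fun_ln _ _); [|pointwise_derive]
  | |- is_derive _ _ (fun y => atan _) _ =>
      notypeclasses refine (is_derive_fun_atan _); pointwise_derive
  | |- is_derive _ _ (fun y => Num.sqrt _) _ =>
      notypeclasses refine (is_derive_fun_sqrt _ _); [|pointwise_derive]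
  | |- is_derive _ _ _ _ => try typeclasses eauto
  end.

Ltac derive_eq :=
  notypeclasses refine (is_derive_val _ _); [pointwise_derive|cbv beta].

(** * Integrals over intervals *)

Section IntervalIntegrals.
Context {R : realType}.
Notation mu := (@lebesgue_measure R).

Lemma within_continuous_integrable (a b : R) (f : R -> R) :
  {within `[a, b], continuous f} -> mu.-integrable `[a, b] (EFin \o f).
Proof.
by move=> cf; apply: continuous_compact_integrable => //; exact: segment_compact.
Qed.

Lemma continuous_integrable (a b : R) (f : R -> R) :
  continuous f -> mu.-integrable `[a, b] (EFin \o f).
Proof.
by move=> cf; apply: within_continuous_integrable; exact: continuous_subspaceT.
Qed.

Lemma is_derive_continuous (f : R -> R) (x df : R) :
  is_derive x 1 f df -> {for x, continuous f}.
Proof.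
by move=> fx; apply/differentiable_continuous/derivable1_diffP; exact: ex_derive.
Qed.

Lemma is_derive_derivable_oo_LRcontinuous (a b : R) (F f : R -> R) : a < b ->
  (forall x, a <= x <= b -> is_derive x 1 F (f x)) ->
  derivable_oo_LRcontinuous F a b.
Proof.
move=> ab dF; split.
- by move=> x; rewrite in_itv/= => /andP[ax xb]; case: (dF x); rewrite ?(ltW ax, ltW xb).
- by apply: cvg_at_right_filter; apply/is_derive_continuous/dF; rewrite lexx ltW.
- by apply: cvg_at_left_filter; apply/is_derive_continuous/dF; rewrite lexx ltW.
Qed.

Lemma integral_is_derive (a b : R) (F f : R -> R) : a <= b ->
  (forall x, a <= x <= b -> is_derive x 1 F (f x)) ->
  {within `[a, b], continuous f} ->
  (\int[mu]_(x in `[a, b]) (f x)%:E = (F b - F a)%:E)%E.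
Proof.
rewrite le_eqVlt => /predU1P[<- _ _|ab dF cf].
  by rewrite set_itv1 integral_set1 subrr.
rewrite (continuous_FTC2 (F := F))// ?EFinB//.
- exact: is_derive_derivable_oo_LRcontinuous dF.
- move=> x; rewrite in_itv/= => /andP[ax xb]; rewrite derive1E.
  by apply: derive_val; apply: dF; rewrite !ltW.
Qed.

Lemma Rintegral_is_derive (a b : R) (F f : R -> R) : a <= b ->
  (forall x, a <= x <= b -> is_derive x 1 F (f x)) ->
  {within `[a, b], continuous f} ->
  \int[mu]_(x in `[a, b]) f x = F b - F a.
Proof. by move=> ab dF cf; rewrite /Rintegral (integral_is_derive ab dF cf). Qed.

Lemma increasing_change_of_variables (a b : R) (F f G : R -> R) : a <= b ->
  {in `[a, b] &, {homo F : x y / x < y}} ->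
  (forall x : R, is_derive x 1 F (f x)) -> continuous f ->
  {within `[F a, F b], continuous G} ->
  (\int[mu]_(x in `[F a, F b]) (G x)%:E =
   \int[mu]_(x in `[a, b]) (G (F x) * f x)%:E)%E.
Proof.
rewrite le_eqVlt => /predU1P[<- _ _ _ _|ab Fi dF cf cG].
  by rewrite !set_itv1 !integral_set1.
have F'E : derive1 F = f by apply/funext => x; rewrite derive1E; apply: derive_val.
rewrite (integration_by_substitution_increasing (F := F) (G := G)) ?F'E//.
- exact: (ltW ab).
- by apply/cvg_ex; exists (f a); apply: cvg_at_right_filter; exact: cf.
- by apply/cvg_ex; exists (f b); apply: cvg_at_left_filter; exact: cf.
- by apply: (is_derive_derivable_oo_LRcontinuous (f := f)).
Qed.

End IntervalIntegrals.

(** * The area of a disc *)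

Section Disc.
Context {R : realType}.
Notation mu := (@lebesgue_measure R).

(** The area of the disc of radius t, as the integral of its chords: the
    substitution x = t sin a turns the integrand into 2 t^2 (cos a)^2, which is
    the derivative of t^2 (a + sin a cos a). *)
Lemma integral_half_chord (t : R) : 0 <= t ->
  (\int[mu]_(x in `[(- t)%R, t]) (2 * Num.sqrt (t ^+ 2 - x ^+ 2))%:E =
   (pi * t ^+ 2)%:E)%E.
Proof.
move=> t0.
have pi0 := pi_gt0 R.
have -> : - t = t * sin (- (pi / 2)) by rewrite sinN sin_pihalf mulrN1.
rewrite [X in `[_, X]](_ : t = t * sin (pi / 2)); last by rewrite sin_pihalf mulr1.
move: t0; rewrite le_eqVlt => /predU1P[<-|t0].
  by rewrite !mul0r set_itv1 integral_set1 expr0n/= mulr0.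
rewrite (@increasing_change_of_variables _ _ _ (fun x => t * sin x) (fun x => t * cos x)); first last.
- apply: continuous_subspaceT => x.
  apply: cvgM; first exact: cvg_cst.
  apply: continuous_cvg; first exact: sqrt_continuous.
  apply: cvgB; first exact: cvg_cst.
  exact: exprn_continuous.
- by move=> x; apply: cvgM; [exact: cvg_cst|exact: continuous_cos].
- by move=> x y xI yI xy; rewrite ltr_pM2l// ltr_sin.
- lra.
rewrite (@eq_integral _ _ _ mu _ (EFin \o (fun x => t ^+ 2 * (2 * cos x ^+ 2)))); last first.
  move=> x; rewrite inE/= in_itv/= => xI.
  rewrite exprMn -[X in X - _]mulr1 -mulrBr -cos2sin2 sqrtrM ?sqr_ge0// !sqrtr_sqr.
  by rewrite ger0_norm ?ltW// ger0_norm ?cos_ge0_pihalf//; congr EFin; ring.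
have dF (x : R) : - (pi / 2) <= x <= pi / 2 ->
    is_derive x 1 (fun x => t ^+ 2 * (x + sin x * cos x)) (t ^+ 2 * (2 * cos x ^+ 2)).
  move=> _; derive_eq.
  apply: subr0_eq; transitivity (t ^+ 2 * (1 - (cos x ^+ 2 + sin x ^+ 2))).
    by rewrite /=; ring.
  by rewrite cos2Dsin2 subrr mulr0.
rewrite (integral_is_derive _ dF); first 1 last.
- lra.
- apply: continuous_subspaceT => x.
  apply: cvgM; first exact: cvg_cst.
  apply: cvgM; first exact: cvg_cst.
  by apply: cvgM; exact: continuous_cos.
by rewrite sinN cosN cos_pihalf sin_pihalf; congr EFin; field.
Qed.

End Disc.

(** * Integrals with an axial symmetry *)

Section AxialSymmetry.
Context {R : realType}.
Notation RT := (measurableTypeR R).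
Notation mu := (@lebesgue_measure R).
Local Open Scope ereal_scope.

Notation mu2 := (mu \x mu).

Lemma measurable_sum_sq (a : R) :
  measurable_fun [set: RT * RT] (fun p : RT * RT => (a + (p.1 ^+ 2 + p.2 ^+ 2))%R).
Proof.
apply: measurable_funD; first exact: measurable_cst.
apply: measurable_funD; apply: measurable_funX.
  exact: measurable_fst.
exact: measurable_snd.
Qed.

Lemma disc_measure (s : R) : (0 <= s)%R ->
  mu2 [set p : RT * RT | p.1 ^+ 2 + p.2 ^+ 2 <= s]%R = (pi * s)%:E.
Proof.
move=> s0; set t := Num.sqrt s.
have t0 : (0 <= t)%R by exact: sqrtr_ge0.
have st : s = (t ^+ 2)%R by rewrite sqr_sqrtr.
rewrite st -integral_half_chord// [RHS]integral_mkcond /product_measure1.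
apply: eq_integral => x _; rewrite patchE; case: ifPn => [/set_mem|/negP xt].
  rewrite /= in_itv/= -ler_norml -[X in (_ <= X)%R](ger0_norm t0) -ler_sqr ?nnegrE// => xt.
  rewrite !real_normK ?num_real// in xt.
  set h := Num.sqrt (t ^+ 2 - x ^+ 2).
  have h2 : (h ^+ 2 = t ^+ 2 - x ^+ 2)%R by rewrite sqr_sqrtr// subr_ge0.
  have h0 : (0 <= h)%R by exact: sqrtr_ge0.
  rewrite (_ : xsection _ _ = `[(- h)%R, h]%classic); last first.
    apply/seteqP; split => y; rewrite xsectionP/= in_itv/= -ler_norml.
      by rewrite -lerBrDl -h2 -[(y ^+ 2)%R]real_normK ?num_real// ler_sqr ?nnegrE.
    move=> yh; rewrite -lerBrDl -h2 -[(y ^+ 2)%R]real_normK ?num_real//.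
    by rewrite ler_sqr ?nnegrE.
  rewrite lebesgue_measure_itv/= lte_fin.
  case: ifPn => [_|]; first by rewrite -EFinB; congr EFin; ring.
  by rewrite -leNgt => hh; rewrite (_ : h = 0%R) ?mulr0//; lra.
have {}xt : (t < `|x|)%R.
  by rewrite ltNge ler_norml; apply/negP => h; apply/xt/mem_set; rewrite /= in_itv.
rewrite /= (_ : xsection _ _ = set0) ?measure0//.
apply/seteqP; split => y//; rewrite xsectionP/= => h.
have : (t ^+ 2 < x ^+ 2)%R.
  by rewrite -[X in (_ < X)%R]real_normK ?num_real// ltr_sqr ?nnegrE.
by have := sqr_ge0 y; lra.
Qed.

(** The annulus is a difference of two discs of squared radii d - a and c - a;
    the maxima with a account for the cases where one or both are empty. *)
Lemma annulus_measure (a c d : R) : (c <= d)%R ->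
  mu2 ((fun p : RT * RT => (a + (p.1 ^+ 2 + p.2 ^+ 2))%R) @^-1` `]c, d]) =
  (pi * (Num.max d a - Num.max c a))%:E.
Proof.
move=> cd.
pose B s := [set p : RT * RT | (p.1 ^+ 2 + p.2 ^+ 2 <= s)%R].
have mB s : measurable (B s).
  rewrite (_ : B s = (fun p : RT * RT => (0 + (p.1 ^+ 2 + p.2 ^+ 2))%R) @^-1` `]-oo, s]).
    by rewrite -[X in measurable X]setTI; exact: measurable_sum_sq.
  by apply/seteqP; split => p; rewrite /B/= in_itv/= add0r.
have muB s : (0 <= s)%R -> mu2 (B s) = (pi * s)%:E by exact: disc_measure.
have sq (p : RT * RT) : (0 <= p.1 ^+ 2 + p.2 ^+ 2)%R by rewrite addr_ge0 ?sqr_ge0.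
have [ad|da] := leP a d; last first.
  rewrite (max_idPr _); last by rewrite (le_trans cd)// ltW.
  rewrite subrr mulr0 (_ : _ @^-1` _ = set0) ?measure0//.
  apply/seteqP; split => p //=; rewrite in_itv/= => /andP[_].
  by have := sq p; lra.
have [ac|ca] := leP a c.
  rewrite (_ : _ @^-1` _ = B (d - a)%R `\` B (c - a)%R).
    have -> : mu2 (B (d - a)%R `\` B (c - a)%R) = mu2 (B (d - a)%R) - mu2 (B (c - a)%R).
      rewrite measureD//.
        by congr (_ - mu2 _); apply/setIidPr => p; rewrite /B/= => h; lra.
      by have := ltry (pi * (d - a))%R; rewrite -muB ?subr_ge0.
    by rewrite !muB ?subr_ge0// -EFinB; congr EFin; ring.
  apply/seteqP; split => p /=; rewrite in_itv/=.
    by move=> /andP[h1 h2]; split; [rewrite /B/=; lra|rewrite /B/= => h; lra].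
  by rewrite /B/= => -[h1 /negP]; rewrite -ltNge => h2; apply/andP; split; lra.
rewrite (_ : _ @^-1` _ = B (d - a)%R).
  by rewrite muB ?subr_ge0.
apply/seteqP; split => p /=; rewrite /B/= in_itv/=.
  by move=> /andP[h1 h2]; lra.
by move=> h; apply/andP; split; have := sq p; lra.
Qed.

(** By [annulus_measure] the image of the plane measure under
    a + y^2 + z^2 gives every interval pi times the length of its part beyond
    a. Completed by the length of the part before a, it agrees with
    pi times Lebesgue measure on all intervals, hence on all Borel sets. *)
Lemma integral_sum_sq (a : R) (f : R -> \bar R) :
  measurable_fun [set: R] f -> (forall x, 0 <= f x) ->
  \int[mu]_y \int[mu]_z f (a + (y ^+ 2 + z ^+ 2))%R =
  pi%:E * \int[mu]_(s in `[a, +oo[) f s.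
Proof.
move=> mf f0.
have pi0 := pi_gt0 R.
have pi1 : (0 <= pi^-1 :> R)%R by rewrite invr_ge0 ltW.
pose phi := (fun p : RT * RT => (a + (p.1 ^+ 2 + p.2 ^+ 2))%R).
have mphi : measurable_fun [set: RT * RT] phi by exact: measurable_sum_sq.
have mfphi : measurable_fun [set: RT * RT] (fun p => f (phi p)).
  exact: measurableT_comp.
rewrite -(fubini_tonelli1 (m1 := mu) (m2 := mu) (fun p => f (phi p)))//.
pose D : set RT := `[a, +oo[%classic.
have mD : measurable D by exact: measurable_itv.
pose E : set RT := `]-oo, a[%classic.
have mE : measurable E by exact: measurable_itv.
pose pf_ : {measure set RT -> \bar R} :=
  pushforward mu2 (phi : _ -> RT).
pose pf := pf_ mphi.
pose m1 : {measure set RT -> \bar R} := mscale (NngNum pi1) pf.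
(* both sides of the comparison with mu must charge the whole line *)
pose m : {measure set RT -> \bar R} := measure_add m1 (mrestr mu mE).
have mDE B : m B = pi^-1%:E * mu2 (phi @^-1` B) + mu (B `&` E).
  by rewrite [LHS]measure_addE.
have muE A : measurable A -> mu A = m A.
  apply: lebesgue_measure_unique => _ [[c d] _ <-].
  rewrite mDE /=.
  have [cd|dc] := leP c d; last first.
    by rewrite set_itv_ge ?bnd_simp -?leNgt ?(ltW dc)// preimage_set0 set0I !measure0 mule0 adde0.
  have -> : mu2 (phi @^-1` `]c, d]) = (pi * (Num.max d a - Num.max c a))%:E.
    exact: annulus_measure.
  rewrite -EFinM mulKf ?gt_eqF//.
  have mui b1 b2 x y : (x <= y)%R ->
      mu [set` Interval (BSide b1 x) (BSide b2 y)] = (y - x)%:E.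
    move=> xy; rewrite lebesgue_measure_itv/= lte_fin.
    by case: ltgtP xy => // -> _; rewrite subrr.
  rewrite mui//.
  have [ad|da] := leP a d; last first.
    rewrite (max_idPr _); last by rewrite (le_trans cd)// ltW.
    rewrite subrr add0e (_ : _ `&` _ = `]c, d]%classic) ?mui//.
    apply/setIidPl => x; rewrite /E/= !in_itv/=; lra.
  have [ac|ca] := leP a c.
    rewrite (_ : _ `&` _ = set0) ?measure0 ?adde0//.
    by apply/seteqP; split => x //=; rewrite /E/= !in_itv/= => -[]; lra.
  rewrite (_ : _ `&` _ = `]c, a[%classic); last first.
    apply/seteqP; split => x //=; rewrite /E/= !in_itv/=; last by lra.
    by move=> [/andP[]]; lra.
  by rewrite mui ?ltW// -EFinD; congr EFin; ring.
have -> : \int[mu]_(s in D) f s = \int[m1]_(s in D) f s.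
  apply: eq_measure_integral => A mA AD.
  rewrite [LHS]muE// mDE (_ : A `&` E = set0) ?measure0 ?adde0//.
  apply/seteqP; split => x //= -[/AD]; rewrite /D /E/= !in_itv/= andbT; lra.
rewrite /m1 ge0_integral_mscale//; last exact: measurable_funTS.
rewrite muleA -EFinM /= divff ?gt_eqF// mul1e.
rewrite ge0_integral_pushforward//; last exact: measurable_funTS.
rewrite (_ : _ @^-1` D = setT)//.
apply/seteqP; split => p // _; rewrite /D/= in_itv/= andbT /phi.
by have := sqr_ge0 p.1; have := sqr_ge0 p.2; lra.
Qed.
Lemma plane_sigma_finite : sigma_finite [set: RT * RT] (mu \x mu).
Proof.
pose I (n : nat) : set RT := `[(- n%:R)%R, n%:R]%classic.
have mI n : measurable (I n) by exact: measurable_itv.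
have muI n : mu (I n) < +oo.
  by rewrite [X in X < _]lebesgue_measure_itv/=; case: ifP => _; rewrite ?ltry// -EFinB ltry.
exists (fun n => I n `*` I n); last first.
  move=> n; split; first exact: measurableX.
  rewrite product_measure1E//; apply: lte_mul_pinfty.
  - exact: measure_ge0.
  - by have := muI n; rewrite -ge0_fin_numE.
  - exact: muI.
apply/seteqP; split => // -[x y] _.
have [n hn] : exists n : nat, (`|x| <= n%:R /\ `|y| <= n%:R)%R.
  exists (maxn (Num.Def.archi_bound `|x|) (Num.Def.archi_bound `|y|)).
  split; [apply: le_trans (ltW (archi_boundP (normr_ge0 x))) _|
          apply: le_trans (ltW (archi_boundP (normr_ge0 y))) _];
    by rewrite ler_nat ?leq_maxl ?leq_maxr.
by exists n => //; rewrite /I /= !in_itv/= -!ler_norml; case: hn.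
Qed.

(** Spherical coordinates for integrands that only see |k|^2 and the axial
    coordinate. For a given axial coordinate x the orthogonal plane enters
    through y^2 + z^2, so that [integral_sum_sq] with a = x^2 applies; then
    Tonelli exchanges x and s = |k|^2. *)
Lemma integral_axially_symmetric (f : RT * RT -> \bar R) :
  measurable_fun [set: RT * RT] f -> (forall p, 0 <= f p) ->
  \int[(mu \x mu) \x mu]_k f (k.1.1 ^+ 2 + k.1.2 ^+ 2 + k.2 ^+ 2, k.1.1)%R =
  pi%:E * \int[mu]_s \int[mu]_(x in [set x | x ^+ 2 <= s]%R) f (s, x).
Proof.
move=> mf f0.
pose h (k : RT * RT * RT) := f (k.1.1 ^+ 2 + k.1.2 ^+ 2 + k.2 ^+ 2, k.1.1)%R.
have m11 : measurable_fun [set: RT * RT * RT] (fun k => k.1.1).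
  by apply: (measurableT_comp measurable_fst); exact: measurable_fst.
have m12 : measurable_fun [set: RT * RT * RT] (fun k => k.1.2).
  by apply: (measurableT_comp measurable_snd); exact: measurable_fst.
have mh : measurable_fun [set: RT * RT * RT] h.
  apply: (measurableT_comp mf); apply/measurable_fun_pair => //.
  apply: measurable_funD; last by apply: measurable_funX; exact: measurable_snd.
  by apply: measurable_funD; apply: measurable_funX.
have h0 k : 0 <= h k by exact: f0.
(* inference of structures on a product looks for factors of finite mass, so
   that the sigma-finiteness of the plane is given by hand *)
pose mm : {sigma_finite_measure set (RT * RT)%type -> \bar R} :=
  HB.pack (mu \x mu : set (RT * RT)%type -> \bar R) (Measure.on (mu \x mu))
    (Measure_isSigmaFinite.Build _ _ _ (mu \x mu) plane_sigma_finite).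
have fub := fubini_tonelli1 (m1 := mm) (m2 := mu) h mh h0.
transitivity (\int[mu \x mu]_x fubini_F mu h x).
  exact: fub.
have mH := measurable_fun_fubini_tonelli_F (m2 := mu) h mh h0.
have H0 p : 0 <= fubini_F mu h p by apply: integral_ge0 => *; exact: f0.
transitivity (\int[mu]_x \int[mu]_y fubini_F mu h (x, y)).
  exact: (fubini_tonelli1 (m1 := mu) (m2 := mu) _ mH H0).
pose g (p : RT * RT) := if (p.1 ^+ 2 <= p.2)%R then f (p.2, p.1) else 0.
have g0 p : 0 <= g p by rewrite /g; case: ifP.
have mg : measurable_fun [set: RT * RT] g.
  apply: measurable_fun_ifT => //.
  - by apply: measurable_fun_ler => //; exact: measurable_funX.
  - by apply: (measurableT_comp mf); exact/measurable_fun_pair.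
transitivity (\int[mu]_x (pi%:E * \int[mu]_s g (x, s))).
  apply: eq_integral => x _; rewrite /fubini_F /h /=.
  transitivity (\int[mu]_y \int[mu]_z f (x ^+ 2 + (y ^+ 2 + z ^+ 2), x)%R).
    by do 2 (apply: eq_integral => ? _); rewrite addrA.
  rewrite (@integral_sum_sq (x ^+ 2)%R (fun s => f (s, x)))//; last first.
    by apply: (measurableT_comp mf); exact/measurable_fun_pair.
  rewrite integral_mkcond; congr (_ * _); apply: eq_integral => s _.
  rewrite patchE /g/=; case: ifPn => [/set_mem|/negP].
    by rewrite /= in_itv/= andbT => ->.
  by case: ifP => // xs []; apply/mem_set; rewrite /= in_itv/= andbT.
rewrite ge0_integralZl//; last 3 first.
- exact: (measurable_fun_fubini_tonelli_F (m2 := mu) g mg g0).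
- by move=> *; exact: integral_ge0.
- by rewrite lee_fin pi_ge0.
rewrite (fubini_tonelli (m1 := mu) (m2 := mu) g)//; congr (_ * _).
apply: eq_integral => s _; rewrite [RHS]integral_mkcond; apply: eq_integral => x _.
rewrite patchE /g/=; case: ifPn => [xs|/negP xs].
  by rewrite mem_set.
by rewrite memNset.
Qed.

End AxialSymmetry.

(** * Oriented integrals as primitives *)

Section OrientedIntegral.
Context {R : realType}.
Notation mu := (@lebesgue_measure R).
Implicit Types f : R -> R.

(** With a base point c to the left of both 0 and x the sign of x does not
    matter any more, so that x may cross 0. *)
Lemma oriented_integral_based f (c x : R) : continuous f -> c <= 0 -> c <= x ->
  oriented_integral 0 x f =
  \int[mu]_(t in `[c, x]) f t - \int[mu]_(t in `[c, 0]) f t.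
Proof.
move=> cf c0 cx; rewrite /oriented_integral.
have split_at (a b : R) : c <= a -> a <= b ->
    \int[mu]_(t in `[c, b]) f t - \int[mu]_(t in `[c, a]) f t =
    \int[mu]_(t in `[a, b]) f t.
  move=> ca ab; rewrite Rintegral_itvB ?bnd_simp//; last exact: continuous_integrable.
  rewrite Rintegral_itv_obnd_cbnd//.
  apply: (@integrableS _ _ _ mu `[a, b]%classic) => //.
    by move=> y /=; rewrite !in_itv/= => /andP[/ltW -> ->].
  exact: continuous_integrable.
case: ifPn => [x0|]; first by rewrite split_at.
by rewrite -ltNge => /ltW x0; rewrite -[in LHS]split_at// opprB.
Qed.

Lemma is_derive_oriented_integral f (x : R) : continuous f ->
  is_derive x 1 (fun y => oriented_integral 0 y f) (f x).
Proof.
move=> cf; pose c := - (`|x| + 1).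
have c0 : c < 0 by rewrite oppr_lt0; have := normr_ge0 x; lra.
have cx : c < x by have := ler_norm (- x); rewrite normrN /c; lra.
have xx1 : x < x + 1 by lra.
have := continuous_FTC1_closed xx1 (continuous_integrable c (x + 1) cf) cx (cf x).
move=> [dF FE].
apply: (@near_eq_is_derive _ _ _
  (fun y => \int[mu]_(t in `[c, y]) f t - \int[mu]_(t in `[c, 0]) f t)).
- near=> y; apply/esym; rewrite (oriented_integral_based (c := c))//; first exact: ltW.
  by apply: ltW; near: y; exact: lt_nbhsr.
- have dint : is_derive x 1 (fun y => \int[mu]_(t in `[c, y]) f t) (f x).
    by apply: (DeriveDef dF); rewrite -derive1E FE.
  by apply: is_derive_val (is_derive_fun_add dint (is_derive_fun_opp
    (is_derive_fun_cst _ _))) _; rewrite oppr0 addr0.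
Unshelve. all: by end_near.
Qed.

Lemma oriented_integral_ge0 f (x : R) : 0 <= x ->
  oriented_integral 0 x f = \int[mu]_(t in `[0, x]) f t.
Proof. by rewrite /oriented_integral => ->. Qed.

Lemma oriented_integral0 f : oriented_integral 0 0 f = 0.
Proof. by rewrite oriented_integral_ge0// set_itv1 Rintegral_set1. Qed.

Lemma oriented_integral_odd f (x : R) : continuous f ->
  (forall y, f (- y) = f y) ->
  oriented_integral 0 (- x) f = - oriented_integral 0 x f.
Proof.
move=> cf fE; wlog x0 : x / 0 <= x.
  move=> h; have [/h//|/ltW x0] := leP 0 x.
  by rewrite -{2}[x]opprK [in RHS]h ?oppr_ge0// opprK.
rewrite [in RHS]oriented_integral_ge0//.
move: x0; rewrite le_eqVlt => /predU1P[<-|x0].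
  by rewrite oppr0 oriented_integral0 set_itv1 Rintegral_set1 oppr0.
rewrite /oriented_integral oppr_ge0 leNgt x0/=; congr (- _).
rewrite -[X in `[_, X]]oppr0 /Rintegral integration_by_substitution_oppr ?ltW//.
- by congr fine; apply: eq_integral => y _ /=; rewrite fE.
- exact: continuous_subspaceT.
Qed.

Lemma Rintegral_even f (x : R) : continuous f -> (forall y, f (- y) = f y) ->
  0 <= x ->
  \int[mu]_(t in `[- x, x]) f t = 2 * \int[mu]_(t in `[0, x]) f t.
Proof.
move=> cf fE x0.
have xx : - x <= x by lra.
have dF (y : R) (_ : - x <= y <= x) := is_derive_oriented_integral y cf.
rewrite (Rintegral_is_derive xx dF); last exact: continuous_subspaceT.
by rewrite oriented_integral_odd// oriented_integral_ge0// opprK mulr2n mulrDl mul1r.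
Qed.

End OrientedIntegral.

(** * The dielectric function *)

Section Psi.
Context {R : realType}.
Notation mu := (@lebesgue_measure R).
Implicit Types x : R.

(** Dawson's integral without its Gaussian factor, scaled for the exponent
    y^2 / 2. *)
Definition dawson_integral x := oriented_integral 0 x (fun y : R => expR (y ^+ 2 / 2)).

Lemma continuous_expR_half_sq : continuous (fun y : R => expR (y ^+ 2 / 2)).
Proof.
move=> x; apply: continuous_cvg; first exact: continuous_expR.
by apply: cvgM; [exact: exprn_continuous|exact: cvg_cst].
Qed.

Lemma continuous_expR_Nhalf_sq : continuous (fun y : R => expR (- (y ^+ 2 / 2))).
Proof.
move=> x; apply: continuous_cvg; first exact: continuous_expR.
by apply: cvgN; apply: cvgM; [exact: exprn_continuous|exact: cvg_cst].
Qed.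

Lemma is_derive_dawson_integral x :
  is_derive x 1 dawson_integral (expR (x ^+ 2 / 2)).
Proof. exact: (is_derive_oriented_integral x continuous_expR_half_sq). Qed.

Lemma PsiRE x : PsiR x = 1 - x * expR (- (x ^+ 2 / 2)) * dawson_integral x.
Proof. by []. Qed.

Lemma continuous_PsiR : continuous (@PsiR R).
Proof.
move=> x; rewrite (_ : PsiR = fun x => 1 - x * expR (- (x ^+ 2 / 2)) * dawson_integral x)//.
apply: cvgB; first exact: cvg_cst.
apply: cvgM; last exact/is_derive_continuous/is_derive_dawson_integral.
by apply: cvgM; [exact: cvg_id|exact: continuous_expR_Nhalf_sq].
Qed.

Lemma continuous_PsiI : continuous (@PsiI R).
Proof.
move=> x; apply: cvgN; apply: cvgM; last exact: continuous_expR_Nhalf_sq.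
by apply: cvgM; [exact: cvg_cst|exact: cvg_id].
Qed.

Lemma PsiI_sq x : PsiI x ^+ 2 = pi / 2 * x ^+ 2 * expR (- (x ^+ 2 / 2)) ^+ 2.
Proof. by rewrite /PsiI sqrrN !exprMn sqr_sqrtr// divr_ge0// pi_ge0. Qed.

Lemma dawson_integral_odd x : dawson_integral (- x) = - dawson_integral x.
Proof.
apply: oriented_integral_odd; first exact: continuous_expR_half_sq.
by move=> y; rewrite sqrrN.
Qed.

Lemma PsiR_even x : PsiR (- x) = PsiR x.
Proof. by rewrite !PsiRE dawson_integral_odd sqrrN mulrN !mulNr opprK. Qed.

Lemma PsiR0 : PsiR (0 : R) = 1.
Proof. by rewrite PsiRE !mul0r subr0. Qed.

Lemma PsiR_le1 x : PsiR x <= 1.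
Proof.
wlog x0 : x / 0 <= x.
  move=> h; have [/h//|/ltW x0] := leP 0 x.
  by rewrite -PsiR_even h ?oppr_ge0.
rewrite PsiRE lerBlDr lerDl mulr_ge0 ?mulr_ge0 ?expR_ge0//.
rewrite /dawson_integral oriented_integral_ge0//.
by apply: Rintegral_ge0 => y _; exact: expR_ge0.
Qed.

Lemma dawson_integral_le x : 0 <= x -> dawson_integral x <= x * expR (x ^+ 2 / 2).
Proof.
move=> x0; rewrite /dawson_integral oriented_integral_ge0//.
rewrite [leRHS](_ : _ = \int[mu]_(t in `[0, x]) cst (expR (x ^+ 2 / 2)) t); last first.
  by rewrite Rintegral_cst//= lebesgue_measure_itv/= lte_fin; move: x0; rewrite le_eqVlt => /predU1P[<-|->];
    rewrite ?ltxx ?mul0r ?mulr0//= subr0 mulrC.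
apply: le_Rintegral => //.
- by apply: continuous_integrable; exact: continuous_expR_half_sq.
- by apply: continuous_integrable; exact: cst_continuous.
- move=> y /=; rewrite in_itv/= => /andP[y0 yx].
  by rewrite ler_expR ler_pM2r// lerXn2r ?nnegrE// (le_trans y0).
Qed.

(** From [dawson_integral_le], whose exponential compensates the Gaussian. *)
Lemma PsiR_ge x : 1 - x ^+ 2 <= PsiR x.
Proof.
wlog x0 : x / 0 <= x.
  move=> h; have [/h//|/ltW x0] := leP 0 x.
  by rewrite -PsiR_even -sqrrN h ?oppr_ge0.
rewrite PsiRE lerB//.
have := dawson_integral_le x0; have := expR_ge0 (- (x ^+ 2 / 2)).
have := expRxMexpNx_1 (x ^+ 2 / 2).
move: (expR (x ^+ 2 / 2)) (expR (- _)) => E E' EE' E'0 h.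
rewrite [leRHS](_ : _ = x * E' * (x * E)); first by apply: ler_wpM2l => //; exact: mulr_ge0.
by rewrite mulrACA [E' * E]mulrC EE' mulr1.
Qed.

(** This is rho^4 |epsilon(rho, x)|^2 at s = rho^2; unlike epsilon it is
    meaningful at s = 0. *)
Definition dielectric (s x : R) : R := (s + PsiR x) ^+ 2 + PsiI x ^+ 2.

(** Since (p + |p|) / 2 is the positive part of p, this is
    a continuous lower bound of [dielectric], uniform in s >= 0. *)
Definition dielectric_bound x : R := ((PsiR x + `|PsiR x|) / 2) ^+ 2 + PsiI x ^+ 2.

(** PsiI only vanishes at 0, where PsiR is 1. *)
Lemma dielectric_bound_gt0 x : 0 < dielectric_bound x.
Proof.
have [->|x0] := eqVneq x 0.
  rewrite /dielectric_bound PsiR0 normr1 (_ : (1 + 1) / 2 = 1 :> R); last by field.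
  by rewrite expr1n ltr_pwDl ?sqr_ge0.
rewrite /dielectric_bound ltr_wpDl ?sqr_ge0// PsiI_sq.
have x2 : 0 < x ^+ 2 by rewrite lt0r sqrf_eq0 x0 sqr_ge0.
by rewrite mulr_gt0 ?exprn_gt0 ?expR_gt0// mulr_gt0// divr_gt0 ?pi_gt0.
Qed.

Lemma dielectric_bound_le s x : 0 <= s -> dielectric_bound x <= dielectric s x.
Proof.
move=> s0; rewrite lerD2r.
have [p0|p0] := leP 0 (PsiR x).
  rewrite ger0_norm// (_ : (PsiR x + PsiR x) / 2 = PsiR x); last by field.
  by rewrite lerXn2r ?nnegrE//; lra.
by rewrite ltr0_norm// subrr mul0r expr0n/= sqr_ge0.
Qed.

Lemma dielectric_gt0 s x : 0 <= s -> 0 < dielectric s x.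
Proof.
by move=> s0; apply: lt_le_trans (dielectric_bound_le x s0); exact: dielectric_bound_gt0.
Qed.

Lemma continuous_dielectric_bound : continuous dielectric_bound.
Proof.
move=> x; have cR := @continuous_PsiR x; have cI := @continuous_PsiI x.
apply: cvgD; last first.
  by apply: (@continuous_cvg _ _ _ _ _ _ (fun y : R => y ^+ 2)); first exact: exprn_continuous.
apply: (@continuous_cvg _ _ _ _ _ _ (fun y : R => y ^+ 2)); first exact: exprn_continuous.
apply: cvgM; last exact: cvg_cst.
by apply: cvgD => //; exact: cvg_norm.
Qed.

Lemma dielectric_even s x : dielectric s (- x) = dielectric s x.
Proof. by rewrite /dielectric PsiR_even !PsiI_sq !sqrrN. Qed.

End Psi.

(** * The function J *)

Section Jfun.
Context {R : realType}.
Notation mu := (@lebesgue_measure R).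
Implicit Types x s rho : R.

Lemma normc_epsilon_sq rho x : 0 < rho ->
  ComplexField.Normc.normc (epsilon rho x) ^+ 2 = dielectric (rho ^+ 2) x / rho ^+ 4.
Proof.
move=> rho0; rewrite /epsilon /ComplexField.Normc.normc/= sqr_sqrtr; last first.
  by rewrite addr_ge0 ?sqr_ge0.
rewrite /dielectric !mul0r subr0 add0r addr0.
by field; rewrite gt_eqF.
Qed.

Definition spectral s x : R := s / dielectric s x.

Lemma spectral_ge0 s x : 0 <= s -> 0 <= spectral s x.
Proof. by move=> s0; rewrite divr_ge0// ltW// dielectric_gt0. Qed.

Lemma continuous_dielectric x : continuous (fun s => dielectric s x).
Proof.
move=> s; apply: cvgD; last exact: cvg_cst.
apply: (@continuous_cvg _ _ _ _ _ _ (fun y : R => y ^+ 2)); first exact: exprn_continuous.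
by apply: cvgD; [exact: cvg_id|exact: cvg_cst].
Qed.

Lemma within_continuous_spectral (K x : R) :
  {within `[0, K], continuous (fun s => spectral s x)}.
Proof.
apply: continuous_in_subspaceT => s; rewrite inE/= in_itv/= => /andP[s0 _].
apply: cvgM; first exact: cvg_id.
apply: cvgV; first by rewrite gt_eqF// dielectric_gt0.
exact: continuous_dielectric.
Qed.

Lemma integrable_spectral (K x : R) :
  mu.-integrable `[0, K] (EFin \o (fun s => spectral s x)).
Proof. by apply: within_continuous_integrable; exact: within_continuous_spectral. Qed.

Lemma JE (k0 x : R) : 0 < k0 ->
  J k0 x = 2 * \int[mu]_(s in `[0, k0 ^+ 2]) spectral s x.
Proof.
move=> k00; rewrite /J; cbv zeta.
pose f (rho : R) := 2^-1 * (spectral (rho ^+ 2) x * (2 * rho)).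
have cf : continuous f.
  move=> rho; apply: cvgM; first exact: cvg_cst.
  apply: cvgM; last by apply: cvgM; [exact: cvg_cst|exact: cvg_id].
  apply: cvgM; first exact: exprn_continuous.
  apply: cvgV; first by rewrite gt_eqF// dielectric_gt0// sqr_ge0.
  apply: (@continuous_cvg _ _ _ _ _ _ (fun s => dielectric s x)).
    exact: continuous_dielectric.
  exact: exprn_continuous.
have intf : mu.-integrable `]0, k0] (EFin \o f).
  apply: (@integrableS _ _ _ mu `[0, k0]%classic) => //; last exact: continuous_integrable.
  by move=> y /=; rewrite !in_itv/= => /andP[/ltW -> ->].
transitivity (4 * \int[mu]_(rho in `]0, k0]) f rho).
  congr (4 * _); apply: eq_Rintegral => rho; rewrite inE/= in_itv/= => /andP[rho0 _].
  rewrite normc_epsilon_sq// /f /spectral.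
  have D0 : dielectric (rho ^+ 2) x != 0 by rewrite gt_eqF// dielectric_gt0// sqr_ge0.
  by field; rewrite D0 gt_eqF.
rewrite Rintegral_itv_obnd_cbnd// RintegralZl//; last first.
  have cf2 : continuous (fun rho => 2 * f rho).
    by move=> r; apply: cvgM; [exact: cvg_cst|exact: cf].
  have := continuous_integrable 0 k0 cf2; congr (mu.-integrable _ _).
  by apply/funext => r /=; rewrite /f mulrA divff// mul1r.
rewrite mulrA (_ : 4 * 2^-1 = 2); last by field.
congr (_ * _); rewrite /Rintegral.
have -> : `[0, k0 ^+ 2]%classic = `[0 ^+ 2, k0 ^+ 2]%classic :> set R by rewrite expr0n.
have incr : {in `[0, k0] &, {homo (fun r : R => r ^+ 2) : x y / x < y}}.
  move=> r s; rewrite !in_itv/= => /andP[r0 _] /andP[s0 _] rs.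
  by rewrite ltrXn2r.
have der (r : R) : is_derive r 1 (fun r : R => r ^+ 2) (2 * r) by derive_eq; ring.
have cder : continuous (fun r : R => 2 * r).
  by move=> r; apply: cvgM; [exact: cvg_cst|exact: cvg_id].
have cG : {within `[0 ^+ 2, k0 ^+ 2], continuous (fun s => spectral s x)}.
  by rewrite expr0n; exact: within_continuous_spectral.
by rewrite (increasing_change_of_variables (ltW k00) incr der cder cG).
Qed.

Lemma J_ge0 (k0 x : R) : 0 < k0 -> 0 <= J k0 x.
Proof.
move=> k00; rewrite JE// mulr_ge0//; apply: Rintegral_ge0 => s/=.
by rewrite in_itv/= => /andP[s0 _]; exact: spectral_ge0.
Qed.

Lemma J_even (k0 x : R) : 0 < k0 -> J k0 (- x) = J k0 x.
Proof.
move=> k00; rewrite (JE _ k00) (JE _ k00); congr (_ * _); apply: eq_Rintegral => s _.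
by rewrite /spectral dielectric_even.
Qed.

(** The two integrands are compared through the difference of their
    denominators. Besides the continuity of J this yields a quadratic bound
    at 0, because PsiR and PsiI^2 vary quadratically there. *)
Lemma J_diff (k0 x y d : R) : 0 < k0 -> 0 < d ->
  d <= dielectric_bound x -> d <= dielectric_bound y ->
  `|J k0 x - J k0 y| <= 2 * (k0 ^+ 2) ^+ 2 / d ^+ 2 *
    (`|PsiR x - PsiR y| * (2 * k0 ^+ 2 + `|PsiR x + PsiR y|) +
     `|PsiI x ^+ 2 - PsiI y ^+ 2|).
Proof.
move=> k00 d0 dx dy; set K := k0 ^+ 2; have K0 : 0 <= K by exact: sqr_ge0.
set M := `|PsiR x - PsiR y| * _ + _.
have M0 : 0 <= M by rewrite addr_ge0 ?mulr_ge0 ?addr_ge0// mulr_ge0.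
rewrite !JE// -/K -mulrBr -RintegralB//; try exact: integrable_spectral.
rewrite normrM ger0_norm// -!mulrA ler_pM2l//.
have intB : mu.-integrable `[0, K] (EFin \o (fun s => spectral s x - spectral s y)).
  rewrite (_ : _ \o _ = ((EFin \o (fun s => spectral s x)) \- (EFin \o (fun s => spectral s y)))%E)//.
  exact: (integrableB _ (integrable_spectral K x) (integrable_spectral K y)).
apply: le_trans (le_normr_Rintegral _ intB) _ => //.
apply: (@le_trans _ _ (\int[mu]_(s in `[0, K]) cst (K / d ^+ 2 * M) s)); last first.
  rewrite Rintegral_cst//= lebesgue_measure_itv/= lte_fin.
  by rewrite ifT ?exprn_gt0//= subr0 le_eqVlt; apply/orP; left; apply/eqP; rewrite /K; field; rewrite gt_eqF.
apply: le_Rintegral => //.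
- have := integrable_norm intB; congr (mu.-integrable _ _).
  exact: continuous_integrable (@cst_continuous _ _ _).
move=> s /=; rewrite in_itv/= => /andP[s0 sK].
have Dx := le_trans dx (dielectric_bound_le x s0).
have Dy := le_trans dy (dielectric_bound_le y s0).
have Dx0 := lt_le_trans d0 Dx; have Dy0 := lt_le_trans d0 Dy.
rewrite (_ : spectral s x - spectral s y =
  s * (dielectric s y - dielectric s x) / (dielectric s x * dielectric s y)); last first.
  by rewrite /spectral; field; rewrite !gt_eqF.
rewrite !normrM (ger0_norm s0) normfV (ger0_norm (mulr_ge0 (ltW Dx0) (ltW Dy0))).
have -> : K / d ^+ 2 * M = K * M / (d * d) by field; rewrite gt_eqF.
apply: ler_pM => //; first by rewrite mulr_ge0.
- by rewrite invr_ge0 mulr_ge0 ?ltW.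
- apply: ler_pM => //.
  rewrite (_ : dielectric s y - dielectric s x =
    - ((PsiR x - PsiR y) * (2 * s + (PsiR x + PsiR y)) + (PsiI x ^+ 2 - PsiI y ^+ 2))).
    rewrite normrN; apply: le_trans (ler_normD _ _) _; rewrite lerD2r normrM ler_wpM2l//.
    apply: le_trans (ler_normD _ _) _; rewrite lerD2r ger0_norm ?mulr_ge0// ler_pM2l//.
  by rewrite /dielectric; ring.
- by rewrite lef_pV2 ?posrE ?mulr_gt0//; apply: ler_pM => //; exact: ltW.
Qed.

Lemma continuous_J (k0 : R) : 0 < k0 -> continuous (J k0).
Proof.
move=> k00 x; pose d := dielectric_bound x / 2.
have d0 : 0 < d by rewrite divr_gt0// dielectric_bound_gt0.
have cR := @continuous_PsiR R x; have cI := @continuous_PsiI R x.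
pose h y := 2 * (k0 ^+ 2) ^+ 2 / d ^+ 2 *
    (`|PsiR x - PsiR y| * (2 * k0 ^+ 2 + `|PsiR x + PsiR y|) +
     `|PsiI x ^+ 2 - PsiI y ^+ 2|).
have h0 : h y @[y --> x] --> 0.
  rewrite [X in _ --> X](_ : _ = h x); last by rewrite /h !subrr !normr0 mul0r addr0 mulr0.
  apply: cvgM; first exact: cvg_cst.
  apply: cvgD.
    apply: cvgM; first by apply: cvg_norm; apply: cvgB; [exact: cvg_cst|exact: cR].
    apply: cvgD; first exact: cvg_cst.
    by apply: cvg_norm; apply: cvgD; [exact: cvg_cst|exact: cR].
  apply: cvg_norm; apply: cvgB; first exact: cvg_cst.
  by apply: (@continuous_cvg _ _ _ _ _ _ (fun y : R => y ^+ 2)); first exact: exprn_continuous.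
apply/cvgrPdist_le => e e0.
move/cvgrPdist_le: h0 => /(_ e e0) hn.
have bn : \forall y \near x, d <= dielectric_bound y.
  have := @continuous_dielectric_bound R x => /cvgrPdist_le/(_ d d0).
  apply: filterS => y; rewrite ler_norml => /andP[_].
  by rewrite /d; lra.
near=> y.
have hy : h y <= e.
  by apply: le_trans (ler_norm _) _; rewrite -normrN -sub0r; near: y.
apply: le_trans _ hy; apply: J_diff => //; last by near: y.
by rewrite /d; have := dielectric_bound_gt0 x; lra.
Unshelve. all: by end_near.
Qed.

End Jfun.

(** * From the integral over the ball to the interval [0, 1] *)

Section Reduction.
Context {R : realType}.
Notation RT := (measurableTypeR R).
Notation mu := (@lebesgue_measure R).

Lemma measurable_inv : measurable_fun [set: R] (fun x : R => x^-1).
Proof.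
rewrite (_ : (fun _ => _) = (fun x : R => if 0 <= x then x `^ (-1) else - ((- x) `^ (-1)))).
  apply: measurable_fun_ifT.
  - by apply: measurable_fun_ler => //; exact: measurable_cst.
  - exact: measurable_powR.
  - apply: measurableT_comp => //.
    by apply: (measurableT_comp (@measurable_powR R (-1))).
apply/funext => x; case: ifPn => [x0|]; first by rewrite powR_inv1.
by rewrite -ltNge => /ltW x0; rewrite powR_inv1 ?oppr_ge0// invrN opprK.
Qed.

Definition gauss_J (k0 y : R) : R := expR (- (y ^+ 2 / 2)) * J k0 y.

Variables (k0 : R) (p : R -> R).
Hypotheses (k00 : 0 < k0) (cp : continuous p) (p0 : forall u, 0 <= p u)
  (pE : forall u, p (- u) = p u).
Let K := k0 ^+ 2.

Definition angular_density (r s u : R) : R :=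
  p u * expR (- ((r * u) ^+ 2 / 2)) * spectral s (r * u).

(** The integrand in the variables s = |k|^2 and k_1. Of the factor |k|^-3, two
    powers combine with |k|^4 / dielectric into [spectral]; for s <= 0 all of
    it vanishes, because the inverse of 0 is 0. *)
Let f r (z : RT * RT) : R :=
  if z.1 <= K then (Num.sqrt z.1)^-1 * angular_density r z.1 (z.2 / Num.sqrt z.1)
  else 0.

Lemma angular_density_ge0 r s u : 0 <= s -> 0 <= angular_density r s u.
Proof.
by move=> s0; rewrite mulr_ge0 ?spectral_ge0// mulr_ge0 ?expR_ge0.
Qed.

Lemma measurable_angular_density r :
  measurable_fun [set: RT * RT] (fun z : RT * RT => angular_density r z.1 z.2).
Proof.
have mr2 : measurable_fun [set: RT * RT] (fun z : RT * RT => r * z.2).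
  by apply: measurable_funM; [exact: measurable_cst|exact: measurable_snd].
apply: measurable_funM.
  apply: measurable_funM.
    apply: (measurableT_comp (f := p)); last exact: measurable_snd.
    exact: continuous_measurable_fun.
  apply: (measurableT_comp (f := fun y : R => expR (- (y ^+ 2 / 2)))) => //.
  by apply: continuous_measurable_fun; exact: continuous_expR_Nhalf_sq.
apply: measurable_funM; first exact: measurable_fst.
apply: (measurableT_comp measurable_inv).
apply: measurable_funD; apply: measurable_funX.
  apply: measurable_funD; first exact: measurable_fst.
  apply: (measurableT_comp (f := PsiR)) => //.
  by apply: continuous_measurable_fun; exact: continuous_PsiR.
apply: (measurableT_comp (f := PsiI)) => //.
by apply: continuous_measurable_fun; exact: continuous_PsiI.
Qed.

Lemma continuous_angular_density r s : 0 <= s -> continuous (angular_density r s).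
Proof.
move=> s0 u.
have cr : (fun u => r * u) @ u --> r * u by apply: cvgM; [exact: cvg_cst|exact: cvg_id].
apply: cvgM.
  apply: cvgM; first exact: cp.
  apply: (@continuous_cvg _ _ _ _ _ _ (fun y : R => expR (- (y ^+ 2 / 2)))) => //.
  exact: continuous_expR_Nhalf_sq.
apply: cvgM; first exact: cvg_cst.
apply: cvgV; first by rewrite gt_eqF// dielectric_gt0.
apply: cvgD; apply: (@continuous_cvg _ _ _ _ _ _ (fun y : R => y ^+ 2)); try exact: exprn_continuous.
  apply: cvgD; first exact: cvg_cst.
  by apply: (@continuous_cvg _ _ _ _ _ _ PsiR) => //; exact: continuous_PsiR.
by apply: (@continuous_cvg _ _ _ _ _ _ PsiI) => //; exact: continuous_PsiI.
Qed.

Let f_ge0 r z : 0 <= f r z.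
Proof.
rewrite /f; case: ifP => // _.
have [s0|s0] := leP 0 z.1.
  by rewrite mulr_ge0 ?invr_ge0 ?sqrtr_ge0// angular_density_ge0.
by rewrite (ler0_sqrtr (ltW s0)) invr0 mul0r.
Qed.

Let measurable_f r : measurable_fun [set: RT * RT] (f r).
Proof.
have msq : measurable_fun [set: RT * RT] (fun z => (Num.sqrt z.1)^-1).
  apply: (measurableT_comp measurable_inv).
  apply: (@measurableT_comp _ _ _ _ _ _ (@Num.sqrt R)); last exact: measurable_fst.
  by apply: continuous_measurable_fun; exact: sqrt_continuous.
apply: measurable_fun_ifT.
- by apply: measurable_fun_ler; [exact: measurable_fst|exact: measurable_cst].
- apply: measurable_funM => //.
  apply: (measurableT_comp (f := fun z : RT * RT => angular_density r z.1 z.2)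
    (g := fun z : RT * RT => (z.1, z.2 / Num.sqrt z.1))).
    exact: measurable_angular_density.
  apply/measurable_fun_pair; first exact: measurable_fst.
  by apply: measurable_funM => //; exact: measurable_snd.
- exact: measurable_cst.
Qed.

(** The scaling x = sqrt s * u; its Jacobian cancels the factor 1 / sqrt s. *)
Lemma integral_angular_slice r s :
  (\int[mu]_(x in [set x | x ^+ 2 <= s]%R) (f r (s, x))%:E =
   if (0 < s <= K)%R then \int[mu]_(u in `[(- 1)%R, 1%R]) (angular_density r s u)%:E
   else 0)%E.
Proof.
rewrite /f/=; have [sK|_] := leP s K; last by rewrite andbF integral0_eq.
rewrite andbT; have [s0|s0] := ltP 0 s; last first.
  by rewrite integral0_eq// => x _; rewrite ler0_sqrtr// invr0 mul0r.
set t := Num.sqrt s; have t0 : 0 < t by rewrite sqrtr_gt0.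
have st : s = t ^+ 2 by rewrite sqr_sqrtr// ltW.
have -> : [set x | x ^+ 2 <= s]%R = `[t * (- 1), t * 1]%classic.
  apply/seteqP; split => x /=; rewrite in_itv/= mulrN !mulr1 -ler_norml st.
    by rewrite -[x ^+ 2]real_normK ?num_real// ler_sqr ?nnegrE// ltW.
  by move=> h; rewrite -[x ^+ 2]real_normK ?num_real// ler_sqr ?nnegrE// ltW.
have le11 : (- 1 <= 1 :> R) by lra.
have incr : {in `[-1, 1] &, {homo (fun u : R => t * u) : x y / x < y}}.
  by move=> x y _ _ xy; rewrite ltr_pM2l.
have der (u : R) : is_derive u 1 (fun u => t * u) t by derive_eq; ring.
have cG : {within `[t * -1, t * 1], continuous (fun x => t^-1 * angular_density r s (x / t))}.
  apply: continuous_subspaceT => x; apply: cvgM; first exact: cvg_cst.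
  apply: (@continuous_cvg _ _ _ _ _ _ (angular_density r s)).
    exact: continuous_angular_density (ltW s0) _.
  by apply: cvgM; [exact: cvg_id|exact: cvg_cst].
rewrite (increasing_change_of_variables le11 incr der (@cst_continuous _ _ _) cG).
apply: eq_integral => u _; congr EFin.
by rewrite mulrAC mulVf ?gt_eqF// mul1r mulrAC divff ?gt_eqF// mul1r.
Qed.

Lemma continuous_gauss_J : continuous (gauss_J k0).
Proof.
by move=> y; apply: cvgM; [exact: continuous_expR_Nhalf_sq|exact: continuous_J].
Qed.

Lemma gauss_J_even y : gauss_J k0 (- y) = gauss_J k0 y.
Proof. by rewrite /gauss_J sqrrN J_even. Qed.

Lemma continuous_angular_gauss_J r : continuous (fun u => p u * gauss_J k0 (r * u)).
Proof.
move=> u; apply: cvgM; first exact: cp.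
apply: (@continuous_cvg _ _ _ _ _ _ (gauss_J k0)); first exact: continuous_gauss_J.
by apply: cvgM; [exact: cvg_cst|exact: cvg_id].
Qed.

(** Tonelli: for a given direction u, the integral over s is half of J at
    r u. The two halves of [-1, 1] contribute equally. *)
Lemma integral_angular_density r :
  (\int[mu]_(s in `]0%R, K]) \int[mu]_(u in `[(- 1)%R, 1%R]) (angular_density r s u)%:E =
   (\int[mu]_(u in `[0%R, 1%R]) (p u * gauss_J k0 (r * u)))%:E)%E.
Proof.
pose S : set RT := `]0, K]%classic; pose U : set RT := `[-1, 1]%classic.
pose h (z : RT * RT) : \bar R :=
  ((fun z : RT * RT => (angular_density r z.1 z.2)%:E) \_ (S `*` U))%E z.
have mSU : measurable (S `*` U) by apply: measurableX; exact: measurable_itv.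
have mh : measurable_fun [set: RT * RT] h.
  apply/(measurable_restrictT _ mSU).
  by apply: measurable_funTS; apply/measurable_EFinP; exact: measurable_angular_density.
have h0 z : (0 <= h z)%E.
  rewrite /h patchE; case: ifPn => // /set_mem [+ _]; rewrite /S/= in_itv/= => /andP[s0 _].
  by rewrite lee_fin angular_density_ge0// ltW.
transitivity (\int[mu]_s \int[mu]_u h (s, u))%E.
  rewrite [LHS]integral_mkcond; apply: eq_integral => s _.
  rewrite patchE; case: ifPn => [/set_mem sS|/negP sS].
    rewrite integral_mkcond; apply: eq_integral => u _; rewrite /h !patchE.
    case: ifPn => [/set_mem uU|/negP uU]; first by rewrite mem_set.
    by rewrite memNset// => -[_ /= uU']; apply: uU; exact/mem_set.
  rewrite integral0_eq// => u _; rewrite /h patchE memNset// => -[/= sS' _].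
  by apply: sS; exact/mem_set.
rewrite (fubini_tonelli (m1 := mu) (m2 := mu) h)//.
transitivity (\int[mu]_(u in `[(- 1)%R, 1%R]) (2^-1 * (p u * gauss_J k0 (r * u)))%:E)%E.
  rewrite [RHS]integral_mkcond; apply: eq_integral => u _.
  rewrite patchE; case: ifPn => [/set_mem uU|/negP uU]; last first.
    rewrite integral0_eq// => s _; rewrite /h patchE memNset// => -[_ /= uU'].
    by apply: uU; exact/mem_set.
  transitivity (\int[mu]_(s in `]0%R, K]) (angular_density r s u)%:E)%E.
    rewrite [RHS]integral_mkcond; apply: eq_integral => s _; rewrite /h !patchE.
    case: ifPn => [/set_mem[sS _]|/negP sS]; first by rewrite mem_set.
    by rewrite memNset// => sS'; apply: sS; exact/mem_set.
  have mq : measurable_fun `]0, K] (fun s : RT => angular_density r s u).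
    apply: measurable_funTS.
    apply: (measurableT_comp (f := fun z : RT * RT => angular_density r z.1 z.2)
      (g := fun s : RT => (s, u))); first exact: measurable_angular_density.
    by apply/measurable_fun_pair.
  rewrite integral_itv_obnd_cbnd; last exact/measurable_EFinP.
  have ispec := integrable_spectral K (r * u).
  under eq_integral do rewrite EFinM.
  rewrite integralZl// -[X in (_ * X)%E]fineK; last exact: integrable_fin_num.
  rewrite -EFinM; congr EFin; rewrite /gauss_J JE// -/K /Rintegral.
  by field.
have cg := @continuous_angular_gauss_J r.
have cg2 : continuous (fun u => 2^-1 * (p u * gauss_J k0 (r * u))).
  by move=> u; apply: cvgM; [exact: cvg_cst|exact: cg].
rewrite -[LHS]fineK; last first.
  by apply: integrable_fin_num => //; exact: continuous_integrable.
congr EFin.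
transitivity (\int[mu]_(u in `[- 1, 1]) (2^-1 * (p u * gauss_J k0 (r * u)))) => //.
have g2E u : 2^-1 * (p (- u) * gauss_J k0 (r * - u)) = 2^-1 * (p u * gauss_J k0 (r * u)).
  by rewrite pE mulrN gauss_J_even.
rewrite (Rintegral_even cg2 g2E ler01) RintegralZl; last 2 first.
- exact: measurable_itv.
- exact: continuous_integrable.
by rewrite mulrA divff ?mul1r// pnatr_eq0.
Qed.

Lemma euclidean_norm_vec3 (k : RT * RT * RT) :
  euclidean_norm (vec3 k) = Num.sqrt (k.1.1 ^+ 2 + k.1.2 ^+ 2 + k.2 ^+ 2).
Proof.
rewrite /euclidean_norm 3!big_ord_recr big_ord0 /= !mxE. by rewrite /= add0r.
Qed.

(** The two eigenvalues correspond to the angular weights u^2 and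
    |1 - u^2| / 2. The absolute value keeps the weight nonnegative outside of
    [-1, 1] without changing it where it is used. *)
Lemma integral3_kernel (W : 'rV[R]_3 -> R) (r : R) :
  (forall k, W k = p (k 0 0 / euclidean_norm k) / euclidean_norm k ^+ 3) ->
  integral3 [set k | euclidean_norm k <= k0] (fun k => W k * Defs.kernel r k) =
  pi * \int[mu]_(u in `[0, 1]) (p u * gauss_J k0 (r * u)).
Proof.
move=> WE; rewrite /integral3 /Rintegral integral_mkcond.
pose F (z : RT * RT) := (f r z)%:E.
transitivity (fine (\int[(mu \x mu) \x mu]_k
    F (k.1.1 ^+ 2 + k.1.2 ^+ 2 + k.2 ^+ 2, k.1.1)%R)).
  congr fine; apply: eq_integral => k _; rewrite patchE /F /f/=.
  set S := k.1.1 ^+ 2 + k.1.2 ^+ 2 + k.2 ^+ 2.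
  have S0 : 0 <= S by rewrite !addr_ge0 ?sqr_ge0.
  have normS : euclidean_norm (vec3 k) = Num.sqrt S by exact: euclidean_norm_vec3.
  have SK : (Num.sqrt S <= k0) = (S <= K).
    by rewrite -ler_sqr ?nnegrE ?sqrtr_ge0 ?(ltW k00)// sqr_sqrtr.
  have -> : (k \in vec3 @^-1` [set k | euclidean_norm k <= k0]) = (S <= K).
    by rewrite -SK -normS; apply/idP/idP => [/set_mem//|h]; exact/mem_set.
  case: ifP => // _; congr EFin.
  rewrite /Defs.kernel WE normS (_ : vec3 k 0 0 = k.1.1); last by rewrite mxE.
  move: S0; rewrite le_eqVlt => /predU1P[<-|S0].
    by rewrite sqrtr0 expr0n/= invr0 mulr0 !mul0r.
  set t := Num.sqrt S; have t0 : 0 < t by rewrite sqrtr_gt0.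
  rewrite normc_epsilon_sq// /angular_density /spectral sqr_sqrtr ?ltW//.
  have D0 := dielectric_gt0 (r * (k.1.1 / t)) (ltW S0).
  have -> : S = t ^+ 2 by rewrite sqr_sqrtr// ltW.
  rewrite (_ : t ^+ 2 = S); last by rewrite sqr_sqrtr// ltW.
  move: (dielectric _ _) (p _) (expR _) D0 => D P E D0.
  have -> : S = t ^+ 2 by rewrite sqr_sqrtr// ltW.
  by field; rewrite !gt_eqF.
have mF : measurable_fun [set: RT * RT] F by apply/measurable_EFinP; exact: (measurable_f r).
have F0 z : (0 <= F z)%E by rewrite lee_fin f_ge0.
rewrite (integral_axially_symmetric mF F0).
transitivity (fine (pi%:E * \int[mu]_(s in `]0%R, K])
    \int[mu]_(u in `[(- 1)%R, 1%R]) (angular_density r s u)%:E)%E); last first.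
  by rewrite integral_angular_density.
congr (fine (pi%:E * _)%E).
rewrite [RHS]integral_mkcond; apply: eq_integral => s _; rewrite patchE.
rewrite [LHS](integral_angular_slice r s) (_ : (s \in _) = (0 < s <= K))//.
apply/idP/idP => [/set_mem|h]; first by rewrite /= in_itv.
by apply/mem_set; rewrite /= in_itv.
Qed.

End Reduction.

(** * Limits at infinity *)

Section Limits.
Context {R : realType}.
Implicit Types (f g : R -> R) (x y : R).

Lemma near_pinfty_ge (A : R) : \forall x \near +oo, A <= x.
Proof. by apply: nbhs_pinfty_ge; exact: num_real. Qed.

Lemma ge0_derive_le f (f' : R -> R) (a b : R) : a <= b ->
  (forall x, a <= x <= b -> is_derive x 1 f (f' x)) ->
  (forall x, a <= x <= b -> 0 <= f' x) -> f a <= f b.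
Proof.
move=> ab df f'0.
have cf : {within `[a, b], continuous f}.
  apply: continuous_in_subspaceT => x; rewrite inE/= in_itv/= => xab.
  exact: is_derive_continuous (df x xab).
have dfoo x : x \in `]a, b[ -> is_derive x 1 f (f' x).
  by rewrite in_itv/= => /andP[ax xb]; apply: df; rewrite !ltW.
have [c cab fE] := MVT_segment ab dfoo cf.
by rewrite -subr_ge0 fE mulr_ge0 ?subr_ge0//; apply: f'0; move: cab; rewrite in_itv.
Qed.

Lemma cvg_pinfty_inv : (x : R)^-1 @[x --> +oo] --> (0 : R).
Proof.
have pos : \forall x \near +oo, 0 < (x : R).
  by near=> x; apply: (lt_le_trans ltr01); near: x; exact: near_pinfty_ge.
exact/(gtr0_cvgV0 pos)/cvg_id.
Unshelve. all: by end_near.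
Qed.

(** The term of degree n + 1 of the exponential series bounds the Gaussian by
    C x^(-2n-2). *)
Lemma cvg_poly_gauss n : x ^+ n * expR (- (x ^+ 2 / 2)) @[x --> +oo] --> (0 : R).
Proof.
pose C : R := n.+1`!%:R * 2 ^+ n.+1.
have C0 : 0 < C by rewrite mulr_gt0 ?exprn_gt0// ltr0n fact_gt0.
apply: (@squeeze_cvgr _ _ _ _ (fun=> 0) (fun x => C * x^-1)); last 2 first.
- exact: cvg_cst.
- by rewrite -[X in _ --> X](mulr0 C); apply: cvgM; [exact: cvg_cst|exact: cvg_pinfty_inv].
near=> x.
have x1 : 1 <= x by near: x; exact: near_pinfty_ge.
have x0 : 0 < x by lra.
rewrite mulr_ge0 ?expR_ge0 ?exprn_ge0 ?(ltW x0)//=.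
have y0 : 0 <= x ^+ 2 / 2 by rewrite divr_ge0 ?sqr_ge0.
have h : (x ^+ 2) ^+ n.+1 / C <= expR (x ^+ 2 / 2).
  apply: le_trans _ (expR_ge1Dxn n y0); rewrite expr_div_n.
  rewrite [X in _ <= 1 + X](_ : _ = (x ^+ 2) ^+ n.+1 / C) ?lerDr//.
  by rewrite /C invfM [in RHS]mulrA mulrAC.
rewrite expRN ler_pdivrMr ?expR_gt0//.
apply: le_trans (_ : C / x * ((x ^+ 2) ^+ n.+1 / C) <= _); last first.
  by apply: ler_wpM2l h; rewrite divr_ge0// ltW.
rewrite (_ : C / x * ((x ^+ 2) ^+ n.+1 / C) = x ^+ n * x ^+ n.+1); last first.
  have -> : (x ^+ 2) ^+ n.+1 = x * (x ^+ n * x ^+ n.+1).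
    by rewrite mulrA -exprS -exprD addnn -mul2n -exprM.
  by move: (x ^+ n * x ^+ n.+1) => Z; field; rewrite !gt_eqF.
by rewrite ler_peMr ?exprn_ge0 ?exprn_ege1// (ltW x0).
Unshelve. all: by end_near.
Qed.

Lemma cvg_quotient_pinfty (N M : R -> R) (l : R) : 0 < l ->
  N x @[x --> +oo] --> l -> M x @[x --> +oo] --> 0 ->
  (\forall x \near +oo, 0 < M x) -> N x / M x @[x --> +oo] --> +oo.
Proof.
move=> l0 cN cM M0; apply/cvgryPge => A.
pose B := `|A| + 1; have B0 : 0 < B by rewrite ltr_wpDl.
have AB : A <= B by have := ler_norm A; rewrite /B; lra.
have lB : 0 < l / 2 / B by rewrite !divr_gt0.
near=> x.
have Nx : l / 2 <= N x by near: x; apply: cvgr_ge cN _ _; lra.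
have Mx : M x <= l / 2 / B by near: x; exact: cvgr_le cM _ lB.
have Mx0 : 0 < M x by near: x.
rewrite ler_pdivlMr//; apply: le_trans (_ : B * M x <= _).
  by rewrite ler_pM2r.
by apply: le_trans Nx; rewrite mulrC -ler_pdivlMr.
Unshelve. all: by end_near.
Qed.

End Limits.

(** * Asymptotics of the dielectric function *)

Section PsiAsymptotics.
Context {R : realType}.
Implicit Types x : R.

(** The first terms of the divergent expansion of [dawson_integral] at
    infinity, in which c is 3. A smaller or larger c makes it a sub- or a
    supersolution of the equation y' = exp(x^2/2) for large x. *)
Definition dawson_expansion (c x : R) : R :=
  expR (x ^+ 2 / 2) * (x^-1 + x ^- 3 + c * x ^- 5).

Lemma is_derive_dawson_expansion c x : 0 < x ->
  is_derive x 1 (dawson_expansion c)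
    (expR (x ^+ 2 / 2) * (1 + (c - 3) * x ^- 4 - 5 * c * x ^- 6)).
Proof.
move=> x0; have xn0 : x != 0 by rewrite gt_eqF.
rewrite /dawson_expansion; derive_eq; rewrite ?expf_neq0//.
by field.
Qed.

(** For c = 0 the derivative of the expansion is the exponential times
    1 - 3/x^4, which is below 1. *)
Lemma dawson_integral_lower x : 1 <= x ->
  dawson_expansion 0 x - dawson_expansion 0 1 <= dawson_integral x.
Proof.
move=> x1.
have d y (hy : 1 <= y <= x) :
    is_derive y 1 (fun y => dawson_integral y - dawson_expansion 0 y)
    (expR (y ^+ 2 / 2) - expR (y ^+ 2 / 2) * (1 + (0 - 3) * y ^- 4 - 5 * 0 * y ^- 6)).
  case/andP: hy => y1 _; apply: is_derive_fun_add; first exact: is_derive_dawson_integral.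
  by apply: is_derive_fun_opp; apply: is_derive_dawson_expansion; lra.
have := ge0_derive_le x1 d.
have d1 : 0 <= dawson_integral (1 : R).
  rewrite /dawson_integral oriented_integral_ge0//.
  by apply: Rintegral_ge0 => y _; exact: expR_ge0.
move=> h; suff : dawson_integral 1 - dawson_expansion 0 1 <=
  dawson_integral x - dawson_expansion 0 x by lra.
apply: h => y /andP[y1 _].
rewrite [leRHS](_ : _ = expR (y ^+ 2 / 2) * (3 * y ^- 4)); last by ring.
by rewrite mulr_ge0 ?expR_ge0// mulr_ge0// invr_ge0 exprn_ge0//; lra.
Qed.

(** For c = 20 the derivative of the expansion is the exponential times
    1 + 17/x^4 - 100/x^6, which is above 1 from x = 3 on. *)
Lemma dawson_integral_upper x : 3 <= x ->
  dawson_integral x <= dawson_expansion 20 x + dawson_integral 3.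
Proof.
move=> x3.
have d y (hy : 3 <= y <= x) :
    is_derive y 1 (fun y => dawson_expansion 20 y - dawson_integral y)
    (expR (y ^+ 2 / 2) * (1 + (20 - 3) * y ^- 4 - 5 * 20 * y ^- 6) - expR (y ^+ 2 / 2)).
  case/andP: hy => y1 _; apply: is_derive_fun_add.
    by apply: is_derive_dawson_expansion; lra.
  by apply: is_derive_fun_opp; exact: is_derive_dawson_integral.
have := ge0_derive_le x3 d.
have d1 : 0 <= dawson_expansion 20 (3 : R).
  rewrite mulr_ge0 ?expR_ge0// !addr_ge0 ?mulr_ge0 ?invr_ge0 ?exprn_ge0//.
move=> h; suff : dawson_expansion 20 3 - dawson_integral 3 <=
  dawson_expansion 20 x - dawson_integral x by lra.
apply: h => y /andP[y3 _].
rewrite [leRHS](_ : _ = expR (y ^+ 2 / 2) * (y ^- 6 * (17 * y ^+ 2 - 100))); last first.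
  by field; rewrite gt_eqF//; lra.
rewrite mulr_ge0 ?expR_ge0// mulr_ge0//; first by rewrite invr_ge0 exprn_ge0//; lra.
nra.
Qed.

(** Both expansions agree up to the order x^-3, and the additive constants
    left by [dawson_integral_lower] and [dawson_integral_upper] are killed by
    the Gaussian. *)
Lemma cvg_sq_PsiR : x ^+ 2 * PsiR x @[x --> +oo] --> (- 1 : R).
Proof.
pose C0 : R := dawson_expansion 0 1; pose C1 : R := dawson_integral 3.
pose E x : R := x ^+ 3 * expR (- (x ^+ 2 / 2)).
have cE : E x @[x --> +oo] --> 0 by exact: cvg_poly_gauss.
have cV2 : x ^- 2 @[x --> +oo] --> (0 : R).
  rewrite (_ : (fun x => x ^- 2) = (fun x => x^-1 * x^-1)); last first.
    by apply/funext => x; rewrite expr2 invfM.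
  by rewrite -[X in _ --> X](mulr0 0); apply: cvgM; exact: cvg_pinfty_inv.
apply: (@squeeze_cvgr _ _ _ _ (fun x => - 1 - 20 * x ^- 2 - C1 * E x)
   (fun x => - 1 + C0 * E x)); last 2 first.
- rewrite -[X in _ --> X](_ : - 1 - 20 * 0 - C1 * 0 = - 1); last by ring.
  apply: cvgB; last by apply: cvgM => //; exact: cvg_cst.
  by apply: cvgB; [exact: cvg_cst|apply: cvgM => //; exact: cvg_cst].
- rewrite -[X in _ --> X](_ : - 1 + C0 * 0 = - 1); last by ring.
  by apply: cvgD; [exact: cvg_cst|apply: cvgM => //; exact: cvg_cst].
near=> x.
have x3 : 3 <= x by near: x; exact: near_pinfty_ge.
have x0 : 0 < x by lra.
have x1 : 1 <= x by lra.
have := dawson_integral_lower x1; have := dawson_integral_upper x3.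
rewrite -/C0 -/C1 PsiRE /dawson_expansion /E.
have := expRxMexpNx_1 (x ^+ 2 / 2).
have := expR_gt0 (- (x ^+ 2 / 2)).
move: (expR (x ^+ 2 / 2)) (expR (- _)) (dawson_integral x) => P N D N0 PN DU DL.
have x3N : 0 <= x ^+ 3 * N by rewrite mulr_ge0 ?exprn_ge0// ltW.
have hL := ler_wpM2l x3N DL; have hU := ler_wpM2l x3N DU.
have xn0 : x != 0 by rewrite gt_eqF.
have EL : x ^+ 3 * N * (P * (x^-1 + x ^- 3 + 0 * x ^- 5) - C0) =
   (P * N) * (x ^+ 2 + 1) - C0 * (x ^+ 3 * N) by field.
have EU : x ^+ 3 * N * (P * (x^-1 + x ^- 3 + 20 * x ^- 5) + C1) =
   (P * N) * (x ^+ 2 + 1 + 20 * x ^- 2) + C1 * (x ^+ 3 * N) by field.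
rewrite EL PN mul1r in hL; rewrite EU PN mul1r in hU.
have -> : x ^+ 2 * (1 - x * N * D) = x ^+ 2 - x ^+ 3 * N * D by ring.
by apply/andP; split; lra.
Unshelve. all: by end_near.
Qed.

Lemma cvg_PsiR : PsiR x @[x --> +oo] --> (0 : R).
Proof.
have h : x^-1 * x^-1 * (x ^+ 2 * PsiR x) @[x --> +oo] --> (0 : R).
  rewrite -[X in _ --> X](_ : 0 * 0 * - 1 = 0); last by ring.
  apply: cvgM; last exact: cvg_sq_PsiR.
  by apply: cvgM; exact: cvg_pinfty_inv.
apply: cvg_trans h; apply: near_eq_cvg; near=> x.
have x1 : 1 <= x by near: x; exact: near_pinfty_ge.
by field; rewrite gt_eqF//; lra.
Unshelve. all: by end_near.
Qed.

Lemma cvg_poly_PsiI n : x ^+ n * - PsiI x @[x --> +oo] --> (0 : R).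
Proof.
rewrite (_ : (fun x => x ^+ n * - PsiI x) =
  (fun x => Num.sqrt (pi / 2) * (x ^+ n.+1 * expR (- (x ^+ 2 / 2))))); last first.
  by apply/funext => x; rewrite /PsiI opprK (exprSr x n); ring.
rewrite -[X in _ --> X](mulr0 (Num.sqrt (pi / 2))).
by apply: cvgM; [exact: cvg_cst|exact: cvg_poly_gauss].
Qed.

Lemma PsiI_gt0 x : 0 < x -> 0 < - PsiI x.
Proof.
by move=> x0; rewrite opprK mulr_gt0 ?expR_gt0// mulr_gt0// sqrtr_gt0 divr_gt0 ?pi_gt0.
Qed.

End PsiAsymptotics.

(** * Asymptotics of J *)

Section JAsymptotics.
Context {R : realType}.
Notation mu := (@lebesgue_measure R).
Implicit Types x : R.

(** The primitive of 2 s / ((s + a)^2 + b^2) is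
    ln ((s + a)^2 + b^2) - 2 a / b * atan ((s + a) / b). *)
Lemma J_closed_form (k0 x : R) : 0 < k0 -> 0 < x ->
  J k0 x = ln (dielectric (k0 ^+ 2) x) - ln (dielectric 0 x) -
    2 * PsiR x / - PsiI x *
      (atan ((k0 ^+ 2 + PsiR x) / - PsiI x) - atan (PsiR x / - PsiI x)).
Proof.
move=> k00 x0; rewrite (JE _ k00) -RintegralZl//; last exact: integrable_spectral.
have b0 := PsiI_gt0 x0.
pose F s := ln (dielectric s x) - 2 * PsiR x / - PsiI x * atan ((s + PsiR x) / - PsiI x).
have K0 : 0 <= k0 ^+ 2 by exact: sqr_ge0.
have dF s : 0 <= s <= k0 ^+ 2 -> is_derive s 1 F (2 * spectral s x).
  move=> /andP[s0 _]; have D0 := dielectric_gt0 x s0.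
  rewrite /F /spectral; move: D0; rewrite /dielectric => D0.
  derive_eq; first exact: D0.
  move: D0 b0; rewrite -[PsiI x ^+ 2]sqrrN.
  move: (PsiR x) (- PsiI x) => a b D0 b0.
  have bn0 : b != 0 by rewrite gt_eqF.
  have Dn0 : (s + a) ^+ 2 + b ^+ 2 != 0 by rewrite gt_eqF.
  have En0 : 1 + ((s + a) / b) ^+ 2 != 0.
    by rewrite gt_eqF// ltr_pwDl ?sqr_ge0.
  have E : 1 + ((s + a) / b) ^+ 2 = ((s + a) ^+ 2 + b ^+ 2) / b ^+ 2 by field.
  by rewrite E; field; rewrite bn0 Dn0.
have cf : {within `[0, k0 ^+ 2], continuous (fun s => 2 * spectral s x)}.
  move=> s; apply: cvgM; first exact: cvg_cst.
  exact: within_continuous_spectral.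
rewrite (Rintegral_is_derive K0 dF cf) /F add0r; ring.
Qed.

Lemma cvg_atan_ratio (N M : R -> R) (l : R) : 0 < l ->
  N x @[x --> +oo] --> l -> M x @[x --> +oo] --> 0 ->
  (\forall x \near +oo, 0 < M x) ->
  atan (N x / M x) @[x --> +oo] --> pi / 2.
Proof.
move=> l0 cN cM M0.
exact: (cvg_comp _ _ (cvg_quotient_pinfty l0 cN cM M0) (@cvgy_atan R)).
Qed.

Lemma near_PsiI_gt0 : \forall x \near +oo, 0 < - PsiI (x : R).
Proof.
near=> x; apply: PsiI_gt0; apply: (lt_le_trans ltr01); near: x; exact: near_pinfty_ge.
Unshelve. all: by end_near.
Qed.

(** The resonance s = - PsiR x lies inside the interval of integration, and
    its width - PsiI x is so small that both ends are infinitely many widths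
    away from it: here the upper end, in [cvg_atan_lower] the lower one. *)
Lemma cvg_atan_upper (k0 : R) : 0 < k0 ->
  atan ((k0 ^+ 2 + PsiR x) / - PsiI x) @[x --> +oo] --> pi / 2.
Proof.
move=> k00; apply: (@cvg_atan_ratio _ _ (k0 ^+ 2)); first exact: exprn_gt0.
- rewrite -[X in _ --> X]addr0; apply: cvgD; [exact: cvg_cst|exact: cvg_PsiR].
- have := @cvg_poly_PsiI R 0; apply: cvg_trans; apply: near_eq_cvg.
  by apply: nearW => x; rewrite expr0 mul1r.
- exact: near_PsiI_gt0.
Qed.

(** The lower end is only at distance |PsiR x|, of order x^-2, from the
    resonance; multiplying by x^2 reduces to a numerator with a positive
    limit. *)
Lemma cvg_atan_lower : atan (PsiR x / - PsiI x) @[x --> +oo] --> - (pi / 2 : R).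
Proof.
have h : - atan (- (x ^+ 2 * PsiR x) / (x ^+ 2 * - PsiI x)) @[x --> +oo] --> - (pi / 2 : R).
  apply: cvgN; apply: (@cvg_atan_ratio _ _ 1) => //.
  - rewrite -[X in _ --> X]opprK; apply: cvgN; exact: cvg_sq_PsiR.
  - exact: cvg_poly_PsiI.
  - near=> x; have x1 : 1 <= x by near: x; exact: near_pinfty_ge.
    have x0 : 0 < x by lra.
    by rewrite mulr_gt0 ?exprn_gt0// PsiI_gt0.
apply: cvg_trans h; apply: near_eq_cvg; near=> x.
have x1 : 1 <= x by near: x; exact: near_pinfty_ge.
have x0 : 0 < x by lra.
have b0 := PsiI_gt0 x0.
rewrite -atanN; congr atan; move: b0; move: (PsiR x) (- PsiI x) => a b b0.
by field; rewrite !gt_eqF.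
Unshelve. all: by end_near.
Qed.

Lemma cvg_cube_gauss_ln_upper (k0 : R) : 0 < k0 ->
  x ^+ 3 * expR (- (x ^+ 2 / 2)) * ln (dielectric (k0 ^+ 2) x) @[x --> +oo] --> (0 : R).
Proof.
move=> k00; rewrite -[X in _ --> X](mul0r (ln ((k0 ^+ 2) ^+ 2))).
apply: cvgM; first exact: cvg_poly_gauss.
apply: continuous_cvg; first by apply: continuous_ln; rewrite !exprn_gt0.
rewrite -[X in _ --> X](_ : (k0 ^+ 2 + 0) ^+ 2 + (- 0) ^+ 2 = _); last first.
  by rewrite addr0 oppr0 expr0n addr0.
apply: cvgD; (apply: (@continuous_cvg _ _ _ _ _ _ (fun y : R => y ^+ 2)); first exact: exprn_continuous).
  by apply: cvgD; [exact: cvg_cst|exact: cvg_PsiR].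
have h : - (x ^+ 0 * - PsiI x) @[x --> +oo] --> - (0 : R) by apply: cvgN; exact: cvg_poly_PsiI.
apply: cvg_trans h; apply: near_eq_cvg.
by apply: nearW => x; rewrite expr0 mul1r opprK.
Qed.

(** At s = 0 the denominator decreases only like x^-4, so that its logarithm
    is negligible against the Gaussian. *)
Lemma cvg_cube_gauss_ln_lower :
  x ^+ 3 * expR (- (x ^+ 2 / 2)) * ln (dielectric 0 x) @[x --> +oo] --> (0 : R).
Proof.
apply: (@squeeze_cvgr _ _ _ _
  (fun x => - 4 * (x ^+ 7 * expR (- (x ^+ 2 / 2)))) (fun=> 0)); last 2 first.
- rewrite -[X in _ --> X](mulr0 (- 4)).
  by apply: cvgM; [exact: cvg_cst|exact: cvg_poly_gauss].
- exact: cvg_cst.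
near=> x.
have x1 : 1 <= x by near: x; exact: near_pinfty_ge.
have x0 : 0 < x by lra.
have ha : x ^+ 2 * PsiR x <= - 2^-1.
  by near: x; apply: cvgr_le (@cvg_sq_PsiR R) _ _; lra.
have ha1 : - 2^-1 <= PsiR x by near: x; apply: cvgr_ge (@cvg_PsiR R) _ _; lra.
have hb : x ^+ 0 * - PsiI x <= 2^-1.
  by near: x; apply: cvgr_le (@cvg_poly_PsiI R 0) _ _; lra.
rewrite expr0 mul1r in hb.
have b0 := PsiI_gt0 x0.
have X0 : 0 < x ^+ 2 by rewrite exprn_gt0.
have a0 : PsiR x < 0 by rewrite -(pmulr_rlt0 _ X0); lra.
set d := dielectric 0 x; have d0 : 0 < d by exact: dielectric_gt0.
have dE : d = PsiR x ^+ 2 + (- PsiI x) ^+ 2 by rewrite /d /dielectric add0r [(- PsiI x) ^+ 2]sqrrN.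
have d1 : d <= 1.
  rewrite dE; move: (PsiR x) (- PsiI x) ha1 hb b0 a0 => a b ha1 hb b0 a0.
  have h1 : a ^+ 2 <= 4^-1 by nra.
  have h2 : b ^+ 2 <= 4^-1 by nra.
  lra.
have lnd : ln d <= 0 by exact: ln_le0.
have dV : d^-1 <= 4 * x ^+ 4.
  rewrite -[leRHS]invrK lef_pV2 ?posrE ?invr_gt0 ?mulr_gt0 ?exprn_gt0// dE.
  apply: (@le_trans _ _ (PsiR x ^+ 2)); last by rewrite lerDl sqr_ge0.
  rewrite invfM -(ler_pM2l (x := 4 * x ^+ 4)) ?mulr_gt0 ?exprn_gt0//.
  rewrite -invfM divff ?gt_eqF ?mulr_gt0 ?exprn_gt0//.
  rewrite (_ : 4 * x ^+ 4 * PsiR x ^+ 2 = 4 * (x ^+ 2 * PsiR x) ^+ 2); last by ring.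
  by move: (x ^+ 2 * PsiR x) ha => z ha; nra.
have lnd' : - ln d <= 4 * x ^+ 4.
  rewrite -lnV ?posrE//; apply: le_trans dV; apply: ltW.
  by apply: ln_sublinear; rewrite invr_gt0.
have E0 : 0 <= x ^+ 3 * expR (- (x ^+ 2 / 2)).
  by rewrite mulr_ge0 ?expR_ge0// exprn_ge0// ltW.
rewrite mulr_ge0_le0// andbT.
rewrite (_ : - 4 * (x ^+ 7 * expR (- (x ^+ 2 / 2))) =
  x ^+ 3 * expR (- (x ^+ 2 / 2)) * (- (4 * x ^+ 4))); last by ring.
by apply: ler_wpM2l => //; lra.
Unshelve. all: by end_near.
Qed.

(** In the closed form of J, x^3 exp(-x^2/2) divided by - PsiI x is
    x^2 / sqrt (pi/2): the exponentials cancel and the arctangents are left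
    with the coefficient - 2 x^2 PsiR x / sqrt (pi/2). *)
Lemma cvg_cube_gauss_J (k0 : R) : 0 < k0 ->
  x ^+ 3 * gauss_J k0 x @[x --> +oo] --> (2 * Num.sqrt (2 * pi) : R).
Proof.
move=> k00.
have pi0 := pi_gt0 R.
set c : R := Num.sqrt (pi / 2); have c0 : 0 < c by rewrite sqrtr_gt0 divr_gt0.
pose h (x : R) := x ^+ 3 * expR (- (x ^+ 2 / 2)) * ln (dielectric (k0 ^+ 2) x) -
  x ^+ 3 * expR (- (x ^+ 2 / 2)) * ln (dielectric 0 x) -
  (2 / c) * (x ^+ 2 * PsiR x) *
      (atan ((k0 ^+ 2 + PsiR x) / - PsiI x) - atan (PsiR x / - PsiI x)).
have hl : h x @[x --> +oo] --> (2 * Num.sqrt (2 * pi) : R).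
  rewrite -[X in _ --> X](_ : 0 - 0 - (2 / c) * (- 1) * (pi / 2 - - (pi / 2)) = _).
    apply: cvgB.
      by apply: cvgB; [exact: cvg_cube_gauss_ln_upper|exact: cvg_cube_gauss_ln_lower].
    apply: cvgM.
      by apply: cvgM; [exact: cvg_cst|exact: cvg_sq_PsiR].
    by apply: cvgB; [exact: cvg_atan_upper|exact: cvg_atan_lower].
  have -> : Num.sqrt (2 * pi) = 2 * c.
    rewrite (_ : 2 * pi = 2 ^+ 2 * (pi / 2)); last by field.
    by rewrite sqrtrM ?sqr_ge0// sqrtr_sqr ger0_norm.
  have c2 : c ^+ 2 = pi / 2 by rewrite sqr_sqrtr// divr_ge0// ltW.
  have -> : (pi : R) = 2 * c ^+ 2 by rewrite c2; field.
  by field; rewrite gt_eqF.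
apply: cvg_trans hl; apply: near_eq_cvg; near=> x.
have x1 : 1 <= x by near: x; exact: near_pinfty_ge.
have x0 : 0 < x by lra.
rewrite /h /gauss_J J_closed_form//.
have -> : 2 * PsiR x / - PsiI x = 2 / c * PsiR x / (x * expR (- (x ^+ 2 / 2))).
  rewrite /PsiI -/c opprK; have := expR_gt0 (- (x ^+ 2 / 2)).
  by move: (expR _) => E E0; field; rewrite !gt_eqF.
have := expR_gt0 (- (x ^+ 2 / 2)).
move: (expR _) (ln _) (ln _) (atan _) (atan _) => E l1 l2 t1 t2 E0.
by field; rewrite !gt_eqF.
Unshelve. all: by end_near.
Qed.

Lemma gauss_J_ge0 (k0 x : R) : 0 < k0 -> 0 <= gauss_J k0 x.
Proof. by move=> k00; rewrite mulr_ge0 ?expR_ge0// J_ge0. Qed.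

(** On [0, 1/2] the denominators stay above 1/2, as PsiR x >= 1 - x^2, and
    [J_diff] applies. *)
Lemma gauss_J_quadratic (k0 : R) : 0 < k0 -> exists C, 0 < C /\
  forall x, 0 <= x <= 2^-1 -> `|gauss_J k0 x - gauss_J k0 0| <= C * x ^+ 2.
Proof.
move=> k00; have pi0 := pi_gt0 R.
pose K := k0 ^+ 2; have K0 : 0 <= K by exact: sqr_ge0.
pose A : R := 2 * K ^+ 2 / (2^-1) ^+ 2.
have A0 : 0 <= A by apply: divr_ge0; [apply: mulr_ge0 => //|]; exact: sqr_ge0.
pose C := A * (2 * K + 2 + pi / 2) + J k0 0 + 1.
have J0 := J_ge0 0 k00.
have C0 : 0 < C.
  have : 0 <= A * (2 * K + 2 + pi / 2) by apply: mulr_ge0 => //; lra.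
  by rewrite /C; lra.
exists C; split=> // x /andP[x0 xh].
have hx2 : x ^+ 2 <= 4^-1 by nra.
have x20 : 0 <= x ^+ 2 by exact: sqr_ge0.
have PR := PsiR_ge x; have PR1 := PsiR_le1 x.
have bx : 2^-1 <= dielectric_bound x.
  rewrite /dielectric_bound ger0_norm; last lra.
  rewrite (_ : (PsiR x + PsiR x) / 2 = PsiR x); last by field.
  apply: (@le_trans _ _ (PsiR x ^+ 2)); last by rewrite lerDl sqr_ge0.
  nra.
have b0 : 2^-1 <= dielectric_bound (0 : R).
  rewrite /dielectric_bound PsiR0 normr1 (_ : (1 + 1) / 2 = 1 :> R); last by field.
  by rewrite expr1n; have := sqr_ge0 (PsiI (0 : R)); lra.
have h2 : 0 < 2^-1 :> R by lra.
have hJ : `|J k0 x - J k0 0| <= A * (2 * K + 2 + pi / 2) * x ^+ 2.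
  apply: le_trans (J_diff k00 h2 bx b0) _; rewrite -/K -/A -mulrA; apply: ler_wpM2l => //.
  rewrite PsiR0 [X in _ + `|_ - X|](_ : _ = 0); last by rewrite PsiI_sq expr0n/= !mulr0 mul0r.
  rewrite subr0 (ger0_norm (sqr_ge0 _)) PsiI_sq ler0_norm; last lra.
  rewrite ger0_norm; last lra.
  have E1 : expR (- (x ^+ 2 / 2)) <= 1 by rewrite expR_le1; lra.
  have E0 := expR_ge0 (- (x ^+ 2 / 2)).
  have E2 : expR (- (x ^+ 2 / 2)) ^+ 2 <= 1 by rewrite expr_le1.
  have h1 : - (PsiR x - 1) * (2 * K + (PsiR x + 1)) <= x ^+ 2 * (2 * K + 2).
    by apply: ler_pM; lra.
  have h3 : pi / 2 * x ^+ 2 * expR (- (x ^+ 2 / 2)) ^+ 2 <= pi / 2 * x ^+ 2.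
    by rewrite ler_piMr// mulr_ge0// divr_ge0// ltW.
  by move: h1 h3; lra.
rewrite /gauss_J expr0n/= mul0r oppr0 expR0 mul1r /C.
move: hJ J0; move: (J k0 x) (J k0 0) => j j0 hJ J0.
have E1 : expR (- (x ^+ 2 / 2)) <= 1 by rewrite expR_le1; lra.
have E2 : 1 - expR (- (x ^+ 2 / 2)) <= x ^+ 2.
  by have := expR_ge1Dx (- (x ^+ 2 / 2)); lra.
move: (expR _) (expR_ge0 (- (x ^+ 2 / 2))) E1 E2 => E E0 E1 E2.
rewrite (_ : E * j - j0 = E * (j - j0) - (1 - E) * j0); last by ring.
apply: le_trans (ler_normB _ _) _; rewrite !normrM (ger0_norm E0) (ger0_norm J0).
rewrite [`|1 - E|]ger0_norm; last lra.
have h1 : E * `|j - j0| <= A * (2 * K + 2 + pi / 2) * x ^+ 2.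
  by apply: le_trans hJ; rewrite ler_piMl.
have h3 : (1 - E) * j0 <= x ^+ 2 * j0 by rewrite ler_wpM2r.
by move: h1 h3; lra.
Qed.

End JAsymptotics.

(** * Dilated moments of a function *)

Section Moments.
Context {R : realType}.
Notation mu := (@lebesgue_measure R).
Implicit Types (r x : R) (n : nat).

Variables (g : R -> R) (L C : R).
Hypotheses (cg : continuous g) (g0 : forall x, 0 <= g x).
Hypotheses (L0 : 0 < L) (gL : x ^+ 3 * g x @[x --> +oo] --> L).
Hypotheses (C0 : 0 < C)
  (gC : forall x, 0 <= x <= 2^-1 -> `|g x - g 0| <= C * x ^+ 2).

Definition moment n r : R := \int[mu]_(u in `[0, 1]) (u ^+ n * g (r * u)).
Definition primitive n r : R := oriented_integral 0 r (fun x => x ^+ n * g x).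

Lemma continuous_monomial_mul n : continuous (fun x : R => x ^+ n * g x).
Proof. by move=> x; apply: cvgM; [exact: exprn_continuous|exact: cg]. Qed.

Lemma continuous_dilation r : continuous (fun u : R => g (r * u)).
Proof.
move=> u; apply: (@continuous_cvg _ _ _ _ _ _ g); first exact: cg.
by apply: cvgM; [exact: cvg_cst|exact: cvg_id].
Qed.

Lemma continuous_moment_integrand n r : continuous (fun u : R => u ^+ n * g (r * u)).
Proof. by move=> u; apply: cvgM; [exact: exprn_continuous|exact: continuous_dilation]. Qed.

Lemma integrable_moment n r :
  mu.-integrable `[0, 1] (EFin \o (fun u => u ^+ n * g (r * u))).
Proof. exact/continuous_integrable/continuous_moment_integrand. Qed.

Lemma is_derive_primitive n x : is_derive x 1 (primitive n) (x ^+ n * g x).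
Proof. exact: (is_derive_oriented_integral x (@continuous_monomial_mul n)). Qed.

Lemma primitive0 n : primitive n 0 = 0.
Proof. exact: oriented_integral0. Qed.

Lemma moment_primitive n r : 0 < r -> moment n r = primitive n r / r ^+ n.+1.
Proof.
move=> r0; have rn0 : r ^+ n.+1 != 0 by rewrite gt_eqF// exprn_gt0.
have dF (u : R) (_ : 0 <= u <= 1) : is_derive u 1 (fun u => primitive n (r * u) / r ^+ n.+1)
    (u ^+ n * g (r * u)).
  have := is_derive_fun_comp (is_derive_primitive n (r * u))
    (is_derive_fun_mul (is_derive_fun_cst r u) (is_derive_fun_id u)).
  move=> /is_derive_fun_mul /(_ (is_derive_fun_cst (r ^+ n.+1)^-1 u)) h.
  apply: is_derive_val h _; rewrite /= exprMn exprS.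
  have rnn : r ^+ n != 0 by rewrite gt_eqF// exprn_gt0.
  move: (primitive n _) (g _) (u ^+ n) (r ^+ n) rnn => P G U Z Z0.
  by field; rewrite Z0 gt_eqF.
rewrite /moment (Rintegral_is_derive ler01 dF).
  by rewrite mulr1 mulr0 primitive0 mul0r subr0.
exact/continuous_subspaceT/continuous_moment_integrand.
Qed.

(** Differentiating the quotient of [moment_primitive] avoids any derivative
    of g. *)
Lemma is_derive_moment n r : 0 < r ->
  is_derive r 1 (moment n) ((g r - n.+1%:R * moment n r) / r).
Proof.
move=> r0; apply: (@near_eq_is_derive _ _ _ (fun y => primitive n y / y ^+ n.+1)).
  near=> y; rewrite moment_primitive//; near: y; exact: lt_nbhsr.
have rn0 : r != 0 by rewrite gt_eqF.
have h := is_derive_fun_mul (is_derive_primitive n r)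
  (@is_derive_fun_inv _ (fun y => y ^+ n.+1) r _ (expf_neq0 n.+1 rn0)
    (is_derive_fun_exp n.+1 (is_derive_fun_id r))).
apply: is_derive_val h _; rewrite moment_primitive//= mulr1 !(exprS r n).
have rnn : r ^+ n != 0 by rewrite expf_neq0.
move: (primitive n r) => P; move: (r ^+ n) rnn => Z Z0.
by field; rewrite rn0 Z0.
Unshelve. all: by end_near.
Qed.

Lemma integral_monomial n (c : R) : \int[mu]_(u in `[0, 1]) (u ^+ n * c) = c / n.+1%:R.
Proof.
have dF (u : R) (_ : 0 <= u <= 1) : is_derive u 1 (fun u => u ^+ n.+1 * (c / n.+1%:R)) (u ^+ n * c).
  derive_eq; rewrite /= mulr0 add0r mulr1.
  have : n.+1%:R != 0 :> R by rewrite pnatr_eq0.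
  by move: (u ^+ n) (n.+1%:R) => Z N N0; field.
rewrite (Rintegral_is_derive ler01 dF).
  by rewrite expr1n mul1r expr0n/= mul0r subr0.
by apply: continuous_subspaceT => u; apply: cvgM; [exact: exprn_continuous|exact: cvg_cst].
Qed.

Lemma moment_at0 n : moment n 0 = g 0 / n.+1%:R.
Proof.
rewrite -integral_monomial; apply: eq_Rintegral => u _; by rewrite mul0r.
Qed.

Lemma moment_ge0 n r : 0 <= moment n r.
Proof.
apply: Rintegral_ge0 => u /=; rewrite in_itv/= => /andP[u0 _].
by rewrite mulr_ge0// exprn_ge0.
Qed.

Lemma moment_le n r (G : R) : 0 <= r -> (forall x, 0 <= x -> g x <= G) -> moment n r <= G.
Proof.
move=> r0 gG; have G0 : 0 <= G by apply: le_trans (gG 0 _).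
apply: (@le_trans _ _ (\int[mu]_(u in `[0, 1]) (u ^+ n * G))).
  apply: le_Rintegral => //.
  - exact: integrable_moment.
  - apply: continuous_integrable => u.
    by apply: cvgM; [exact: exprn_continuous|exact: cvg_cst].
  - move=> u /=; rewrite in_itv/= => /andP[u0 _].
    by apply: ler_wpM2l; [exact: exprn_ge0|apply: gG; exact: mulr_ge0].
by rewrite integral_monomial ler_pdivrMr// ler_peMr// ler1n.
Qed.

Lemma moment_anti r : moment 2 r <= moment 0 r.
Proof.
apply: le_Rintegral => //; try exact: integrable_moment.
move=> u /=; rewrite in_itv/= => /andP[u0 u1].
by apply: ler_wpM2r => //; rewrite expr0 expr_le1.
Qed.

Lemma moment_quadratic n r : 0 <= r <= 2^-1 ->
  `|moment n r - moment n 0| <= C * r ^+ 2.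
Proof.
move=> /andP[r0 rh].
rewrite /moment -RintegralB//; try exact: integrable_moment.
have cD : continuous (fun u : R => u ^+ n * g (r * u) - u ^+ n * g (0 * u)).
  by move=> u; apply: cvgB; exact: continuous_moment_integrand.
have iD := continuous_integrable 0 1 cD.
apply: le_trans (le_normr_Rintegral _ iD) _ => //.
apply: (@le_trans _ _ (\int[mu]_(u in `[0, 1]) (u ^+ 0 * (C * r ^+ 2)))); last first.
  by rewrite integral_monomial divr1.
apply: le_Rintegral => //.
- have cn : continuous (fun u : R => `|u ^+ n * g (r * u) - u ^+ n * g (0 * u)|).
    by move=> u; apply: cvg_norm; exact: cD.
  exact: (continuous_integrable 0 1 cn).
- apply: continuous_integrable => u.
  by apply: cvgM; [exact: exprn_continuous|exact: cvg_cst].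
move=> u /=; rewrite in_itv/= => /andP[u0 u1].
rewrite mul0r expr0 mul1r -mulrBr normrM ger0_norm ?exprn_ge0//.
have ru : 0 <= r * u <= 2^-1.
  rewrite mulr_ge0//=; apply: le_trans rh; by rewrite ler_piMr.
apply: (@le_trans _ _ (1 * (C * (r * u) ^+ 2))).
  apply: ler_pM => //; first exact: exprn_ge0.
    by rewrite exprn_ile1.
  exact: gC.
rewrite mul1r ler_pM2l// exprMn ler_piMr ?sqr_ge0//.
by rewrite expr_le1.
Qed.

Lemma decay_bound : exists G, 0 < G /\ forall x, 0 <= x -> (1 + x) ^+ 3 * g x <= G.
Proof.
have [X [X1 hX]] : exists X, 1 <= X /\ forall x, X <= x -> x ^+ 3 * g x <= 2 * L.
  have [M [_ hM]] : \forall x \near +oo, x ^+ 3 * g x <= 2 * L.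
    have L2 : L < 2 * L by move: L0; lra.
    exact: (cvgr_le _ gL _ L2).
  exists (Num.max 1 (M + 1)); split; first by rewrite le_max lexx.
  by move=> x; rewrite ge_max => /andP[_ xM]; apply: hM; lra.
have cf : continuous (fun x : R => (1 + x) ^+ 3 * g x).
  move=> x; apply: cvgM; last exact: cg.
  apply: (@continuous_cvg _ _ _ _ _ _ (fun y : R => y ^+ 3)); first exact: exprn_continuous.
  by apply: cvgD; [exact: cvg_cst|exact: cvg_id].
have X0 : 0 <= X by lra.
have [c cX hc] := EVT_max X0 (continuous_subspaceT cf).
have gc0 := g0 c.
have hc0 : 0 <= (1 + c) ^+ 3 * g c.
  by rewrite mulr_ge0// exprn_ge0//; move: cX; rewrite in_itv/=; lra.
exists (16 * L + (1 + c) ^+ 3 * g c); split; first by move: L0; lra.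
have L1 := L0; have gx0 := g0.
move=> x x0; have [xX|xX] := leP X x.
  have := hX _ xX => h.
  have h8 : (1 + x) ^+ 3 <= 8 * x ^+ 3.
    rewrite (_ : 8 * x ^+ 3 = (2 * x) ^+ 3); last by ring.
    by rewrite lerXn2r ?nnegrE; lra.
  have := ler_wpM2r (g0 x) h8; rewrite -mulrA; move: hc0 h L1; lra.
have := hc x; rewrite in_itv/= x0 (ltW xX) => /(_ isT); move: L1; lra.
Qed.

Lemma near_ln2 (A : R) : \forall r \near +oo, A <= ln (2 + r).
Proof.
near=> r.
have rA : expR A <= r by near: r; exact: near_pinfty_ge.
have r2 : 0 < 2 + r by have := expR_gt0 A; lra.
by rewrite -[leLHS]expRK ler_ln ?posrE ?expR_gt0//; lra.
Unshelve. all: by end_near.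
Qed.

(** A form of the rule of l'Hospital: the derivatives x^2 g(x) and 1 / (2 + x)
    have a quotient tending to L, so that primitive 2 - L ln (2 + x) grows at
    most like a small multiple of ln (2 + x). *)
Lemma cvg_primitive2_ln : primitive 2 r / ln (2 + r) @[r --> +oo] --> L.
Proof.
have hL : (2 + x) * x ^+ 2 * g x @[x --> +oo] --> L.
  have h : (2 * x^-1 + 1) * (x ^+ 3 * g x) @[x --> +oo] --> L.
    rewrite -[X in _ --> X](_ : (2 * 0 + 1) * L = L); last by rewrite mulr0 add0r mul1r.
    apply: cvgM; last exact: gL.
    by apply: cvgD; [apply: cvgM; [exact: cvg_cst|exact: cvg_pinfty_inv]|exact: cvg_cst].
  apply: cvg_trans h; apply: near_eq_cvg; near=> x.
  have x1 : 1 <= x by near: x; exact: near_pinfty_ge.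
  by move: (g x) => gx; field; rewrite gt_eqF//; lra.
apply/cvgrPdist_le => e e0.
have e2 : 0 < e / 2 by lra.
move/cvgrPdist_le : hL => /(_ _ e2) [M [_ hM]].
pose X := Num.max 1 (M + 1).
have X1 : 1 <= X by rewrite le_max lexx.
have XM : M + 1 <= X by rewrite le_max lexx orbT.
have hX x : X <= x -> `|L - (2 + x) * x ^+ 2 * g x| <= e / 2 by move=> ?; apply: hM; lra.
pose D r := primitive 2 r - L * ln (2 + r).
have dD (x : R) : 0 <= x -> is_derive x 1 D (x ^+ 2 * g x - L * (2 + x)^-1).
  move=> x0; apply: is_derive_fun_add; first exact: is_derive_primitive.
  apply: is_derive_fun_opp; derive_eq; first lra.
  by rewrite /=; ring.
have dl (x : R) : 0 <= x -> is_derive x 1 (fun r => e / 2 * ln (2 + r)) (e / 2 * (2 + x)^-1).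
  by move=> x0; derive_eq; first lra; rewrite /=; ring.
have key x : X <= x -> `|x ^+ 2 * g x - L * (2 + x)^-1| <= e / 2 * (2 + x)^-1.
  move=> xX; have x2 : 0 < 2 + x by lra.
  rewrite (_ : x ^+ 2 * g x - _ = - ((L - (2 + x) * x ^+ 2 * g x) * (2 + x)^-1)).
    rewrite normrN normrM [`|(2 + x)^-1|]ger0_norm ?invr_ge0 ?(ltW x2)//.
    by apply: ler_wpM2r; [rewrite invr_ge0 ltW|exact: hX].
  by move: (g x) => gx; field; rewrite gt_eqF.
have bd r : X <= r -> `|D r - D X| <= e / 2 * ln (2 + r) - e / 2 * ln (2 + X).
  move=> Xr; rewrite ler_norml; apply/andP; split.
  - suff : e / 2 * ln (2 + X) + D X <= e / 2 * ln (2 + r) + D r by lra.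
    apply: (ge0_derive_le Xr (fun x (hx : X <= x <= r) =>
      is_derive_fun_add (dl x _) (dD x _))) => [x /andP[Xx _]|x /andP[Xx _]|x /andP[Xx _]].
    + lra.
    + lra.
    + by have := key x Xx; rewrite ler_norml; lra.
  - suff : e / 2 * ln (2 + X) - D X <= e / 2 * ln (2 + r) - D r by lra.
    apply: (ge0_derive_le Xr (fun x (hx : X <= x <= r) =>
      is_derive_fun_add (dl x _) (is_derive_fun_opp (dD x _)))) => [x /andP[Xx _]|x /andP[Xx _]|x /andP[Xx _]].
    + lra.
    + lra.
    + by have := key x Xx; rewrite ler_norml; lra.
have lX0 : 0 <= ln (2 + X) by apply: ln_ge0; lra.
near=> r.
have Xr : X <= r by near: r; exact: near_pinfty_ge.
have l1 : 1 <= ln (2 + r) by near: r; exact: near_ln2.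
have lD : `|D X| / (e / 2) <= ln (2 + r) by near: r; exact: near_ln2.
have l0 : 0 < ln (2 + r) by lra.
rewrite (_ : L - _ = - (D r / ln (2 + r))); last first.
  by rewrite /D; move: (primitive 2 r) (ln _) l0 => P l l0; field; rewrite gt_eqF.
rewrite normrN normrM [`|_^-1|]ger0_norm ?invr_ge0 ?(ltW l0)// ler_pdivrMr//.
have h1 := bd r Xr.
have h2 : `|D X| <= e / 2 * ln (2 + r) by rewrite mulrC -ler_pdivrMr.
have h3 : `|D r| <= `|D r - D X| + `|D X|.
  by rewrite -{1}(subrK (D X) (D r)); exact: ler_normD.
have h4 : 0 <= e / 2 * ln (2 + X) by rewrite mulr_ge0// ltW.
move: h1 h2 h3 h4; move: `|D r| `|D X| `|D r - D X| (ln (2 + r)) (ln (2 + X)).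
by move=> a b c d f; lra.
Unshelve. all: by end_near.
Qed.

End Moments.

(** * Bounds and limits of moments *)

Section MomentBounds.
Context {R : realType}.
Notation mu := (@lebesgue_measure R).
Implicit Types (r x : R) (n : nat).

Variables (g : R -> R) (L C G : R).
Hypotheses (cg : continuous g) (g0 : forall x, 0 <= g x).
Hypotheses (L0 : 0 < L) (gL : x ^+ 3 * g x @[x --> +oo] --> L).
Hypotheses (C0 : 0 < C)
  (gC : forall x, 0 <= x <= 2^-1 -> `|g x - g 0| <= C * x ^+ 2).
Hypotheses (G0 : 0 < G) (gG : forall x, 0 <= x -> (1 + x) ^+ 3 * g x <= G).

Local Notation moment := (moment g).
Local Notation primitive := (primitive g).

Lemma decay_le n x : 0 <= x -> (n <= 3)%N -> (1 + x) ^+ n * g x <= G.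
Proof.
move=> x0 n3; apply: le_trans (gG x0); apply: ler_wpM2r; first exact: g0.
by apply: ler_weXn2l => //; lra.
Qed.

Lemma decay_le1 x : 0 <= x -> g x <= G.
Proof. by move=> x0; have := decay_le x0 (leq0n 3); rewrite expr0 mul1r. Qed.

Lemma primitive_ge0 n r : 0 <= r -> 0 <= primitive n r.
Proof.
move=> r0; rewrite /primitive oriented_integral_ge0//.
by apply: Rintegral_ge0 => x /=; rewrite in_itv/= => /andP[x0 _]; rewrite mulr_ge0// exprn_ge0.
Qed.

Lemma primitive2_le r : 0 <= r -> primitive 2 r <= G * ln (1 + r).
Proof.
move=> r0; rewrite -subr_ge0.
have dF (x : R) : 0 <= x <= r -> is_derive x 1 (fun x => G * ln (1 + x) - primitive 2 x)
    (G * (1 + x)^-1 - x ^+ 2 * g x).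
  move=> /andP[x0 _]; apply: is_derive_fun_add.
    by derive_eq; first lra; rewrite /=; ring.
  by apply: is_derive_fun_opp; exact: is_derive_primitive.
have := ge0_derive_le r0 dF.
rewrite addr0 ln1 mulr0 (primitive0 g) subr0; apply => x /andP[x0 _].
have x1 : 0 < 1 + x by lra.
rewrite subr_ge0 ler_pdivlMr//.
apply: le_trans (gG x0); rewrite (_ : x ^+ 2 * g x * (1 + x) = x ^+ 2 * (1 + x) * g x); last by ring.
apply: ler_wpM2r; first exact: g0.
by rewrite (exprSr (1 + x) 2); apply: ler_wpM2r; [exact: ltW|rewrite lerXn2r ?nnegrE; lra].
Qed.

Lemma primitive0_le r : 0 <= r -> primitive 0 r <= G.
Proof.
move=> r0; apply: (@le_trans _ _ (G * (1 - (1 + r)^-1))); last first.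
  have : 0 <= G * (1 + r)^-1 by rewrite mulr_ge0 ?(ltW G0)// invr_ge0; lra.
  by rewrite mulrBr mulr1; lra.
rewrite -subr_ge0.
have dF (x : R) : 0 <= x <= r ->
    is_derive x 1 (fun x => G * (1 - (1 + x)^-1) - primitive 0 x)
    (G * (1 + x) ^- 2 - x ^+ 0 * g x).
  move=> /andP[x0 _]; apply: is_derive_fun_add.
    by derive_eq; first (by rewrite gt_eqF//; lra); rewrite /=; ring.
  by apply: is_derive_fun_opp; exact: is_derive_primitive.
have := ge0_derive_le r0 dF.
rewrite addr0 invr1 subrr mulr0 (primitive0 g) subr0; apply => x /andP[x0 _].
have x1 : 0 < (1 + x) ^+ 2 by apply: exprn_gt0; lra.
rewrite subr_ge0 ler_pdivlMr// expr0 mul1r mulrC.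
exact: decay_le.
Qed.

Lemma ln2_ge_half r : 0 <= r -> 2^-1 <= ln (2 + r).
Proof.
move=> r0; have h : -1 < - 2^-1 :> R by lra.
have := le_ln1Dx h; rewrite (_ : 1 + - 2^-1 = 2^-1 :> R); last by field.
rewrite lnV ?posrE// => h2; apply: (@le_trans _ _ (ln 2)); first by move: (ln 2) h2 => l h2; lra.
by rewrite ler_ln ?posrE; lra.
Qed.

Lemma inv_le_scale (a b k : R) : 0 < a -> 0 < b -> b <= k * a -> a^-1 <= k * b^-1.
Proof. by move=> a0 b0 h; rewrite ler_pdivlMr// mulrC ler_pdivrMr. Qed.

Lemma inv_cube_le r : 1 <= r -> r ^- 3 <= 8 * (1 + r) ^- 3.
Proof.
move=> r1; apply: inv_le_scale; try (apply: exprn_gt0; lra).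
rewrite (_ : 8 * r ^+ 3 = (2 * r) ^+ 3); last by ring.
by rewrite lerXn2r ?nnegrE; lra.
Qed.

(** For r <= 1 the moment is at most G, while ln (2 + r) >= 1/2 and
    (1 + r)^3 <= 8. For r > 1 the integral of x^2 g is at most G ln (1 + r),
    because x^2 g(x) <= G / (1 + x). *)
Lemma moment2_bound r : 0 <= r -> moment 2 r <= 16 * G * ln (2 + r) * (1 + r) ^- 3.
Proof.
move=> r0; have hl := ln2_ge_half r0.
have Gp := G0.
have [r1|r1] := leP r 1.
  apply: (le_trans (moment_le cg g0 _ r0 decay_le1)).
  have r3 : (1 + r) ^+ 3 <= 8.
    by rewrite (_ : 8 = 2 ^+ 3 :> R); [rewrite lerXn2r ?nnegrE; lra|ring].
  have r30 : 0 < (1 + r) ^+ 3 by apply: exprn_gt0; lra.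
  rewrite ler_pdivlMr//.
  move: (ln _) ((1 + r) ^+ 3) hl r3 r30 => l z hl r3 r30.
  apply: (@le_trans _ _ (G * 8)); first by rewrite ler_pM2l.
  by rewrite [16 * G]mulrC -mulrA ler_pM2l//; lra.
have r01 : 0 < r by lra.
rewrite (moment_primitive cg)//.
have h1 := primitive2_le r0.
have h2 : ln (1 + r) <= ln (2 + r) by rewrite ler_ln ?posrE; lra.
have h3 := inv_cube_le (ltW r1).
have r30 : 0 <= r ^- 3 by rewrite invr_ge0 exprn_ge0.
apply: (@le_trans _ _ (G * ln (2 + r) * (8 * (1 + r) ^- 3))).
  apply: ler_pM => //; first exact: primitive_ge0.
  by apply: le_trans h1 _; rewrite ler_pM2l.
have z0 : 0 <= (1 + r) ^- 3 by rewrite invr_ge0 exprn_ge0//; lra.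
have : 0 <= G * ln (2 + r) * (1 + r) ^- 3 by rewrite mulr_ge0// mulr_ge0//; lra.
by move: (ln _) ((1 + r) ^- 3) => l z; lra.
Qed.

Lemma moment0_bound r : 0 <= r -> moment 0 r <= 3 * G * (2 + r)^-1.
Proof.
move=> r0; have Gp := G0.
have r2 : 0 < 2 + r by lra.
rewrite ler_pdivlMr//.
have [r1|r1] := leP r 1.
  have h := moment_le cg g0 0 r0 decay_le1.
  rewrite [3 * G]mulrC; apply: ler_pM => //; [exact: moment_ge0|lra|lra].
have r01 : 0 < r by lra.
rewrite (moment_primitive cg)// expr1 mulrAC ler_pdivrMr//.
have h := primitive0_le r0.
apply: (@le_trans _ _ (G * (2 + r))); first by rewrite ler_pM2r.
by rewrite [3 * G]mulrC -mulrA ler_pM2l//; lra.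
Qed.

(** The derivative of [moment], by [is_derive_moment]. *)
Definition dmoment n r : R := (g r - n.+1%:R * moment n r) / r.

(** The numerator vanishes at 0, since (n + 1) N_n(0) = g(0), and both terms
    vary quadratically. *)
Lemma dmoment_small n r : 0 < r <= 2^-1 -> `|dmoment n r| <= n.+2%:R * C.
Proof.
move=> /andP[r0 rh].
have rI : 0 <= r <= 2^-1 by rewrite ltW.
have h1 := gC rI; have h2 := moment_quadratic cg C0 gC n rI.
have E : g r - n.+1%:R * moment n r = (g r - g 0) - n.+1%:R * (moment n r - moment n 0).
  rewrite (moment_at0 g).
  have : n.+1%:R != 0 :> R by rewrite pnatr_eq0.
  by move: (moment n r) (g r) (g 0) (n.+1%:R) => m a b N N0; field.
rewrite /dmoment E normrM normfV (ger0_norm (ltW r0)) ler_pdivrMr//.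
apply: le_trans (ler_normB _ _) _.
rewrite normrM ger0_norm ?ler0n//.
apply: (@le_trans _ _ (C * r ^+ 2 + n.+1%:R * (C * r ^+ 2))).
  by apply: lerD => //; apply: ler_wpM2l.
rewrite (_ : C * r ^+ 2 + n.+1%:R * (C * r ^+ 2) = n.+2%:R * C * r ^+ 2); last first.
  by rewrite -[n.+2%:R]natr1; ring.
apply: ler_wpM2l; first by rewrite mulr_ge0// ltW.
by rewrite expr2 ler_piMr ?ltW//; lra.
Qed.

(** For r <= 1/2 the bound 4 C of [dmoment_small] is used with
    ln (2 + r) >= 1/2 and (1 + r)^4 <= 16. For larger r, 1/r <= 3 / (1 + r)
    and g r + 3 N_2(r) <= 50 G ln (2 + r) / (1 + r)^3. *)
Lemma dmoment2_bound r : 0 < r ->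
  `|dmoment 2 r| <= (150 * G + 128 * C) * ln (2 + r) * (1 + r) ^- 4.
Proof.
move=> r0; have Gp := G0; have Cp := C0; have hl := ln2_ge_half (ltW r0).
have r40 : 0 < (1 + r) ^+ 4 by apply: exprn_gt0; lra.
have [rh|rh] := leP r 2^-1.
  have rI : 0 < r <= 2^-1 by rewrite r0.
  apply: le_trans (dmoment_small 2 rI) _; rewrite ler_pdivlMr//.
  have r4 : (1 + r) ^+ 4 <= 16.
    by rewrite (_ : 16 = 2 ^+ 4 :> R); [rewrite lerXn2r ?nnegrE; lra|ring].
  apply: (@le_trans _ _ (4 * C * 16)); first by rewrite ler_pM2l// mulr_gt0.
  apply: (@le_trans _ _ ((150 * G + 128 * C) * 2^-1)); first lra.
  by rewrite ler_pM2l//; lra.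
rewrite /dmoment normrM normfV (ger0_norm (ltW r0)).
have r10 : 0 < 1 + r by lra.
have h1 : g r <= G * (1 + r) ^- 3.
  by rewrite ler_pdivlMr ?exprn_gt0// mulrC; apply: gG; exact: ltW.
have h2 := moment2_bound (ltW r0).
have m0 := moment_ge0 g0 2 r.
have gr0 := g0 r.
have hr : r^-1 <= 3 * (1 + r)^-1.
  by apply: inv_le_scale => //; lra.
apply: (@le_trans _ _ (50 * G * ln (2 + r) * (1 + r) ^- 3 * (3 * (1 + r)^-1))).
  apply: ler_pM => //; first by rewrite invr_ge0 ltW.
  apply: le_trans (ler_normB _ _) _; rewrite normrM !ger0_norm//.
  have h3 : G * (1 + r) ^- 3 <= 2 * ln (2 + r) * (G * (1 + r) ^- 3).
    by rewrite ler_peMl ?mulr_ge0 ?(ltW G0) ?invr_ge0 ?exprn_ge0 ?(ltW r10)//; lra.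
  move: h1 h2 h3; move: (g r) (moment 2 r) (ln _) ((1 + r) ^- 3) => a b l z h1 h2 h3.
  have h4 : 2 * l * (G * z) = 2 * (G * l * z) by ring.
  have h5 : 16 * G * l * z = 16 * (G * l * z) by ring.
  have h6 : 50 * G * l * z = 50 * (G * l * z) by ring.
  by rewrite h6; rewrite h4 in h3; rewrite h5 in h2; lra.
rewrite (_ : 50 * G * ln (2 + r) * (1 + r) ^- 3 * (3 * (1 + r)^-1) =
  150 * G * ln (2 + r) * (1 + r) ^- 4); last first.
  by move: (ln _) => l; field; rewrite gt_eqF.
apply: ler_wpM2r; first by rewrite invr_ge0 ltW.
by apply: ler_wpM2r; lra.
Qed.

(** For r <= 1/2 the bound 2 C of [dmoment_small] is used with
    (2 + r)^2 <= 9. For larger r, 1/r <= 5 / (2 + r) and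
    g r + N_0(r) <= 5 G / (2 + r). *)
Lemma dmoment0_bound r : 0 < r ->
  `|dmoment 0 r| <= (25 * G + 18 * C) * (2 + r) ^- 2.
Proof.
move=> r0; have Gp := G0; have Cp := C0.
have r20 : 0 < 2 + r by lra.
have r220 : 0 < (2 + r) ^+ 2 by apply: exprn_gt0.
have [rh|rh] := leP r 2^-1.
  have rI : 0 < r <= 2^-1 by rewrite r0.
  apply: le_trans (dmoment_small 0 rI) _; rewrite ler_pdivlMr//.
  have r4 : (2 + r) ^+ 2 <= 3 ^+ 2 by rewrite lerXn2r ?nnegrE; lra.
  apply: (@le_trans _ _ (2 * C * 3 ^+ 2)); first by rewrite ler_pM2l// mulr_gt0.
  by rewrite (_ : 2 * C * 3 ^+ 2 = 18 * C); [lra|ring].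
rewrite /dmoment normrM normfV (ger0_norm (ltW r0)).
have r10 : 0 < 1 + r by lra.
have h1 : g r <= 2 * G * (2 + r)^-1.
  rewrite ler_pdivlMr//; apply: (@le_trans _ _ (2 * ((1 + r) ^+ 1 * g r))).
    rewrite expr1 mulrA [g r * _]mulrC; apply: ler_wpM2r => //; lra.
  by rewrite ler_pM2l//; apply: decay_le => //; exact: ltW.
have h2 := moment0_bound (ltW r0).
have m0 := moment_ge0 g0 0 r.
have gr0 := g0 r.
have hr : r^-1 <= 5 * (2 + r)^-1.
  by apply: inv_le_scale => //; lra.
apply: (@le_trans _ _ (5 * G * (2 + r)^-1 * (5 * (2 + r)^-1))).
  apply: ler_pM => //; first by rewrite invr_ge0 ltW.
  apply: le_trans (ler_normB _ _) _; rewrite mul1r !ger0_norm//.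
  by move: h1 h2; move: (g r) (moment 0 r) ((2 + r)^-1) => a b z; lra.
rewrite (_ : 5 * G * (2 + r)^-1 * (5 * (2 + r)^-1) = 25 * G * (2 + r) ^- 2); last first.
  by field; rewrite gt_eqF.
apply: ler_wpM2r; first by rewrite invr_ge0 ltW.
lra.
Qed.

Lemma dmoment20_bound r : 0 < r ->
  `|dmoment 2 r| <= 4 * (150 * G + 128 * C) * (2 + r) ^- 2.
Proof.
move=> r0; have Gp := G0; have Cp := C0.
apply: le_trans (dmoment2_bound r0) _.
have r10 : 0 < 1 + r by lra.
have r20 : 0 < 2 + r by lra.
have h1 : ln (2 + r) <= 1 + r.
  rewrite (_ : 2 + r = 1 + (1 + r)); last by ring.
  by apply: le_ln1Dx; lra.
have h2 : ln (2 + r) * (1 + r) ^- 4 <= 4 * (2 + r) ^- 2.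
  apply: (@le_trans _ _ ((1 + r) * (1 + r) ^- 4)).
    by apply: ler_wpM2r => //; rewrite invr_ge0 exprn_ge0// ltW.
  rewrite (_ : (1 + r) * (1 + r) ^- 4 = (1 + r) ^- 3); last by field; rewrite gt_eqF.
  apply: inv_le_scale; try exact: exprn_gt0.
  apply: (@le_trans _ _ (4 * (1 + r) ^+ 2)); last first.
    by rewrite ler_pM2l//; apply: ler_weXn2l => //; lra.
  rewrite (_ : 4 * (1 + r) ^+ 2 = (2 * (1 + r)) ^+ 2); last by ring.
  by rewrite lerXn2r ?nnegrE; lra.
rewrite -mulrA [4 * _]mulrC -[leRHS]mulrA; apply: ler_wpM2l => //; lra.
Qed.

Lemma cvg_moment2 : moment 2 r * ((1 + r ^+ 3) / ln (2 + r)) @[r --> +oo] --> L.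
Proof.
have h : primitive 2 r / ln (2 + r) * (r^-1 * r^-1 * r^-1 + 1) @[r --> +oo] --> L.
  rewrite -[X in _ --> X](_ : L * (0 * 0 * 0 + 1) = L); last by ring.
  apply: cvgM; first exact: cvg_primitive2_ln.
  apply: cvgD; last exact: cvg_cst.
  by do ?apply: cvgM; exact: cvg_pinfty_inv.
apply: cvg_trans h; apply: near_eq_cvg; near=> r.
have r1 : 1 <= r by near: r; exact: near_pinfty_ge.
have r0 : 0 < r by lra.
rewrite (moment_primitive cg)//.
have := ln2_ge_half (ltW r0); move: (ln _) (primitive 2 r) => l P hl.
by field; rewrite !gt_eqF//; lra.
Unshelve. all: by end_near.
Qed.

Lemma primitive_nondecreasing : {homo primitive 0 : x y / x <= y}.
Proof.
move=> x y xy; apply: (ge0_derive_le xy (fun z _ => is_derive_primitive cg 0 z)) => z _.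
by rewrite expr0 mul1r.
Qed.

Lemma cvg_primitive0 :
  primitive 0 r @[r --> +oo] --> \int[mu]_(x in `[0, +oo[) g x.
Proof.
have ub : has_ubound (range (primitive 0)).
  exists G => _ [x _ <-]; have [x0|x0] := leP 0 x; first exact: primitive0_le.
  by apply: le_trans (primitive_nondecreasing (ltW x0)) _; rewrite (primitive0 g) ltW.
have cv := nondecreasing_cvgr primitive_nondecreasing ub.
rewrite (Rintegral_ge0_continuous_FTC2y (F := primitive 0) _ _ cv).
- by rewrite (primitive0 g) subr0.
- by move=> x _; exact: g0.
- exact: continuous_subspaceT.
- by move=> x _; case: (is_derive_primitive cg 0 x).
- apply: cvg_at_right_filter.
  exact: (is_derive_continuous (is_derive_primitive cg 0 0)).
- move=> x _; rewrite derive1E; case: (is_derive_primitive cg 0 x) => _ ->.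
  by rewrite expr0 mul1r.
Qed.

(** On an interval [X, X + 1] far enough g is at least
    L / 2 / (X + 1)^3. *)
Lemma integral_halfline_gt0 : 0 < \int[mu]_(x in `[0, +oo[) g x.
Proof.
have [X [X1 hX]] : exists X, 1 <= X /\ forall x, X <= x -> L / 2 <= x ^+ 3 * g x.
  have [M [_ hM]] : \forall x \near +oo, L / 2 <= x ^+ 3 * g x.
    have L2 : L / 2 < L by move: L0; lra.
    exact: (cvgr_ge _ gL _ L2).
  exists (Num.max 1 (M + 1)); split; first by rewrite le_max lexx.
  by move=> x; rewrite ge_max => /andP[_ xM]; apply: hM; lra.
have Lp := L0.
pose c := L / 2 / (X + 1) ^+ 3.
have c0 : 0 < c by rewrite divr_gt0 ?exprn_gt0//; lra.
have XX : X <= X + 1 by lra.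
have dF (x : R) : X <= x <= X + 1 -> is_derive x 1 (fun x => primitive 0 x - c * x) (x ^+ 0 * g x - c).
  move=> _; apply: is_derive_fun_add; first exact: is_derive_primitive.
  apply: is_derive_fun_opp.
  apply: is_derive_val (is_derive_fun_mul (is_derive_fun_cst c x) (is_derive_fun_id x)) _.
  by rewrite mulr1 mulr0 addr0.
have h : 0 < primitive 0 (X + 1).
  have := ge0_derive_le XX dF => hh.
  have : primitive 0 X - c * X <= primitive 0 (X + 1) - c * (X + 1).
    apply: hh => x /andP[x1 x2].
    rewrite expr0 mul1r subr_ge0 ler_pdivrMr ?exprn_gt0//; last lra.
    apply: le_trans (hX x x1) _; rewrite mulrC; apply: ler_wpM2l; first exact: g0.
    by rewrite lerXn2r ?nnegrE; lra.
  have : 0 <= primitive 0 X by apply: primitive_ge0; lra.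
  by rewrite mulrDr; lra.
apply: lt_le_trans h _.
rewrite -(cvg_lim (@Rhausdorff R) cvg_primitive0).
apply: limr_ge; first exact: (cvgP _ cvg_primitive0).
near=> y; apply: primitive_nondecreasing; near: y; exact: near_pinfty_ge.
Unshelve. all: by end_near.
Qed.

Lemma cvg_moment_diff : (1 + r) * ((moment 0 r - moment 2 r) / 2) @[r --> +oo] -->
  (\int[mu]_(x in `[0, +oo[) g x) / 2.
Proof.
set I := \int[mu]_(x in _) _.
have cV := @cvg_pinfty_inv R.
have c2 : primitive 2 r * (r^-1 * r^-1) @[r --> +oo] --> (0 : R).
  apply: (@squeeze_cvgr _ _ _ _ (fun=> 0) (fun r => G * r^-1)); last 2 first.
  - exact: cvg_cst.
  - by rewrite -[X in _ --> X](mulr0 G); apply: cvgM; [exact: cvg_cst|exact: cV].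
  near=> r.
  have r1 : 1 <= r by near: r; exact: near_pinfty_ge.
  have r0 : 0 < r by lra.
  have i0 : 0 <= r^-1 by rewrite invr_ge0 ltW.
  rewrite mulr_ge0 ?mulr_ge0 ?primitive_ge0 ?(ltW r0)//=.
  rewrite mulrA; apply: ler_wpM2r => //; rewrite ler_pdivrMr//.
  apply: le_trans (primitive2_le (ltW r0)) _; rewrite ler_pM2l//.
  by apply: le_ln1Dx; lra.
have h : (r^-1 + 1) * ((primitive 0 r - primitive 2 r * (r^-1 * r^-1)) / 2) @[r --> +oo] --> I / 2.
  rewrite -[X in _ --> X](_ : (0 + 1) * ((I - 0) / 2) = I / 2); last by rewrite add0r mul1r subr0.
  apply: cvgM; first by apply: cvgD; [exact: cV|exact: cvg_cst].
  apply: cvgM; last exact: cvg_cst.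
  by apply: cvgB; [exact: cvg_primitive0|exact: c2].
apply: cvg_trans h; apply: near_eq_cvg; near=> r.
have r1 : 1 <= r by near: r; exact: near_pinfty_ge.
have r0 : 0 < r by lra.
rewrite !(moment_primitive cg)//.
move: (primitive 0 r) (primitive 2 r) => P Q.
by field; rewrite gt_eqF.
Unshelve. all: by end_near.
Qed.

End MomentBounds.

(** * Derivatives of radial functions *)

Section Radial.
Context {R : realType}.
Implicit Types (v e : 'rV[R]_3) (M : R -> R).

Lemma is_derive_along_line (f : 'rV[R]_3 -> R) v e (d : R) :
  is_derive (0 : R) 1 (fun t : R => f (t *: e + v)) d -> is_derive v e f d.
Proof.
move=> [df dE].
have E : (fun h : R => h^-1 *: (((fun t : R => f (t *: e + v)) \o shift 0) (h *: (1 : R)) -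
      f (0 *: e + v))) =
   (fun h : R => h^-1 *: ((f \o shift v) (h *: e) - f v)).
  by apply/funext => h /=; rewrite addr0 scale0r add0r /GRing.scale/= mulr1.
apply: DeriveDef; first by rewrite /derivable -E; exact: df.
by rewrite /derive -E; exact: dE.
Qed.

Lemma sum_sq_along_axis v (i : 'I_3) (t : R) :
  \sum_(j < 3) (t *: delta_mx 0 i + v) 0 j ^+ 2 =
  \sum_(j < 3) v 0 j ^+ 2 + (2 * v 0 i * t + t ^+ 2).
Proof.
rewrite (eq_bigr (fun j => v 0 j ^+ 2 + (if j == i then 2 * v 0 j * t + t ^+ 2 else 0))).
  by rewrite big_split/= -big_mkcond/= big_pred1_eq.
move=> j _; rewrite !mxE eqxx/=; case: eqVneq => _ /=.
  by rewrite mulr1; ring.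
by rewrite mulr0 add0r addr0.
Qed.

Lemma sum_sq_ge0 v : 0 <= \sum_(j < 3) v 0 j ^+ 2.
Proof. by apply: sumr_ge0 => j _; exact: sqr_ge0. Qed.

Lemma euclidean_norm_ge0 v : 0 <= euclidean_norm v.
Proof. exact: sqrtr_ge0. Qed.

Lemma euclidean_norm_coord v (i : 'I_3) : `|v 0 i| <= euclidean_norm v.
Proof.
rewrite -sqrtr_sqr ler_sqrt ?sum_sq_ge0//.
by rewrite (bigD1 i)//= lerDl; apply: sumr_ge0 => j _; exact: sqr_ge0.
Qed.

Lemma is_derive_radial M v (i : 'I_3) (m : R) : 0 < euclidean_norm v ->
  is_derive (euclidean_norm v) 1 M m ->
  is_derive v (delta_mx 0 i) (fun w => M (euclidean_norm w))
    (m * (v 0 i / euclidean_norm v)).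
Proof.
move=> v0 dM; apply: is_derive_along_line.
have S0 : 0 < \sum_(j < 3) v 0 j ^+ 2 by rewrite -sqrtr_gt0.
rewrite (_ : (fun t : R => M (euclidean_norm (t *: delta_mx 0 i + v))) =
  (fun t : R => M (Num.sqrt (\sum_(j < 3) v 0 j ^+ 2 + (2 * v 0 i * t + t ^+ 2))))); last first.
  by apply/funext => t; rewrite /euclidean_norm sum_sq_along_axis.
have E0 : \sum_(j < 3) v 0 j ^+ 2 + (2 * v 0 i * 0 + 0 ^+ 2) = \sum_(j < 3) v 0 j ^+ 2.
  by rewrite mulr0 expr0n/= !addr0.
apply: is_derive_fun_comp; first by rewrite E0.
derive_eq; first by rewrite E0.
rewrite E0 -/(euclidean_norm v) /GRing.scale/= expr1.
move: (euclidean_norm v) v0 (v 0 i) => s s0 a.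
by field; rewrite gt_eqF.
Qed.

(** A radial function is even along a line through the origin; being flat to
    second order it has derivative 0 there. *)
Lemma is_derive_radial0 M v (i : 'I_3) (C : R) : euclidean_norm v = 0 ->
  (forall r, 0 <= r <= 2^-1 -> `|M r - M 0| <= C * r ^+ 2) ->
  is_derive v (delta_mx 0 i) (fun w => M (euclidean_norm w)) 0.
Proof.
move=> v0 hM.
have S0 : \sum_(j < 3) v 0 j ^+ 2 = 0.
  by apply/eqP; rewrite eq_le sum_sq_ge0 andbT -sqrtr_eq0; exact/eqP.
have vi : v 0 i = 0.
  by apply/eqP; rewrite -normr_le0 -v0; exact: euclidean_norm_coord.
apply: is_derive_along_line.
rewrite (_ : (fun t : R => M (euclidean_norm (t *: delta_mx 0 i + v))) =
  (fun t : R => M `|t|)); last first.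
  apply/funext => t; rewrite /euclidean_norm sum_sq_along_axis S0 vi.
  by rewrite mulr0 mul0r !add0r sqrtr_sqr.
have cv : (fun h : R => h^-1 *: (((fun t : R => M `|t|) \o shift 0) (h *: (1 : R)) -
      M `|0 : R|)) @ 0^' --> (0 : R).
  pose D := `|C| + 1; have D0 : 0 < D by rewrite ltr_wpDl.
  have CD : C <= D by have := ler_norm C; rewrite /D; lra.
  apply/cvgr0Pnorm_le => e e0.
  have eD : 0 < e / D by exact: divr_gt0.
  have h2 : 0 < 2^-1 :> R by lra.
  near=> h.
  have h0 : h != 0 by near: h; exact: nbhs_dnbhs_neq.
  have hh : `|h| <= 2^-1 by near: h; exact: dnbhs0_le.
  have he : `|h| <= e / D by near: h; exact: dnbhs0_le.
  rewrite /= addr0 normr0 /GRing.scale/= mulr1 normrM normfV ler_pdivrMl ?normr_gt0//.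
  have hr : 0 <= `|h| <= 2^-1 by rewrite normr_ge0.
  apply: le_trans (hM _ hr) _; rewrite expr2 mulrCA; apply: ler_wpM2l => //.
  apply: (@le_trans _ _ (D * `|h|)); first exact: ler_wpM2r.
  by rewrite mulrC -ler_pdivlMr.
apply: DeriveDef; first exact: cvgP cv.
exact: (cvg_lim (@Rhausdorff R) cv).
Unshelve. all: by end_near.
Qed.

Lemma multi_derive_order_le1 (beta : 'I_3 -> nat) : (mdegree beta <= 1)%N ->
  (mdegree beta = 0%N /\ forall f : 'rV[R]_3 -> R, multi_derive beta f = f) \/
  (mdegree beta = 1%N /\ exists i, forall f : 'rV[R]_3 -> R,
     multi_derive beta f = 'D_(delta_mx 0 i) f).
Proof.
have E (f : 'rV[R]_3 -> R) : multi_derive beta f = iter (beta ord0) (partial ord0)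
  (iter (beta (lift ord0 ord0)) (partial (lift ord0 ord0))
     (iter (beta (lift ord0 (lift ord0 ord0))) (partial (lift ord0 (lift ord0 ord0))) f)).
  by rewrite /multi_derive !enum_ordSl/= enum_ord0.
rewrite /mdegree !big_ord_recl big_ord0 addn0.
move: E; case: (beta ord0) => [|[|a]]; case: (beta (lift ord0 ord0)) => [|[|b]];
  case: (beta (lift ord0 (lift ord0 ord0))) => [|[|c]] //= E _.
- by left.
- by right; split => //; eexists => f; rewrite E; reflexivity.
- by right; split => //; eexists => f; rewrite E; reflexivity.
- by right; split => //; eexists => f; rewrite E; reflexivity.
Qed.

End Radial.

(** * The eigenvalues *)

Section Eigenvalues.
Context {R : realType}.
Notation mu := (@lebesgue_measure R).
Implicit Types r x : R.

Definition prefactor : R := (Num.sqrt (2 * pi))^-1 * pi.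

Lemma prefactor_gt0 : 0 < prefactor.
Proof. by rewrite mulr_gt0 ?pi_gt0// invr_gt0 sqrtr_gt0 mulr_gt0// pi_gt0. Qed.

Lemma sqr_sqrt_2pi : Num.sqrt (2 * pi) ^+ 2 = 2 * pi :> R.
Proof. by rewrite sqr_sqrtr// mulr_ge0// pi_ge0. Qed.

Lemma lambda1_moment (k0 r : R) : 0 < k0 ->
  lambda1 k0 r = prefactor * moment (gauss_J k0) 2 r.
Proof.
move=> k00; rewrite /lambda1 /prefactor -mulrA; congr (_ * _).
apply: (integral3_kernel (p := fun u => u ^+ 2) k00) => [|u|u|k].
- exact: exprn_continuous.
- exact: sqr_ge0.
- by rewrite sqrrN.
have [->|n0] := eqVneq (euclidean_norm k) 0.
  by rewrite !expr0n/= !invr0 !mulr0.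
by field.
Qed.

Lemma euclidean_norm_sq_sub (k : 'rV[R]_3) : k 0 1 ^+ 2 + k 0 2 ^+ 2 =
  euclidean_norm k ^+ 2 - k 0 0 ^+ 2.
Proof.
rewrite /euclidean_norm sqr_sqrtr ?sum_sq_ge0// 3!big_ord_recl big_ord0 addr0.
rewrite (_ : lift ord0 ord0 = 1); last exact/val_inj.
rewrite (_ : lift ord0 (lift ord0 ord0) = 2); last exact/val_inj.
by rewrite [RHS]addrC addKr.
Qed.

Lemma lambda2_moment (k0 r : R) : 0 < k0 ->
  lambda2 k0 r = prefactor *
    ((moment (gauss_J k0) 0 r - moment (gauss_J k0) 2 r) / 2).
Proof.
move=> k00; have cg := continuous_gauss_J k00.
transitivity (prefactor * \int[mu]_(u in `[0, 1]) (`|1 - u ^+ 2| / 2 * gauss_J k0 (r * u))).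
  rewrite /lambda2 /prefactor -mulrA; congr (_ * _).
  apply: (integral3_kernel (p := fun u => `|1 - u ^+ 2| / 2) k00) => [u|u|u|k].
  - apply: cvgM; last exact: cvg_cst.
    by apply: cvg_norm; apply: cvgB; [exact: cvg_cst|exact: exprn_continuous].
  - by rewrite divr_ge0.
  - by rewrite sqrrN.
  rewrite euclidean_norm_sq_sub.
  have [->|n0] := eqVneq (euclidean_norm k) 0.
    by rewrite !expr0n/= mulr0 !invr0 !mulr0.
  rewrite (_ : 1 - _ ^+ 2 = (euclidean_norm k ^+ 2 - k 0 0 ^+ 2) / euclidean_norm k ^+ 2); last by field.
  rewrite ger0_norm; first by field.
  by rewrite -euclidean_norm_sq_sub divr_ge0 ?addr_ge0 ?sqr_ge0.
congr (_ * _); rewrite /moment -RintegralB//; try exact: integrable_moment.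
have cD : continuous (fun u : R => u ^+ 0 * gauss_J k0 (r * u) - u ^+ 2 * gauss_J k0 (r * u)).
  by move=> u; apply: cvgB; exact: continuous_moment_integrand.
rewrite -RintegralZr//; last exact: (continuous_integrable 0 1 cD).
apply: eq_Rintegral => u; rewrite inE/= in_itv/= => /andP[u0 u1].
rewrite ger0_norm; last by rewrite subr_ge0 expr_le1.
by move: (gauss_J k0 _) => G; rewrite expr0; field.
Qed.

End Eigenvalues.

Theorem lemma8 (R : realType) (k0 : R) (hk0 : 0 < k0) :
  [/\ asymp_equiv (lambda1 k0)
        (fun r => 2 * pi * (ln (2 + r) / (1 + r ^+ 3))),
      asymp_equiv (lambda2 k0)
        (fun r => Num.sqrt (pi / 8) *
          ((\int[@lebesgue_measure R]_(y in `[0%R, +oo[)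
              (expR (- (y ^+ 2 / 2)) * J k0 y)) / (1 + r))),
      (forall (i : 'I_3) (v : 'rV[R]_3),
        derivable (fun w => lambda1 k0 (euclidean_norm w)) v (delta_mx 0 i) /\
        derivable (fun w => lambda2 k0 (euclidean_norm w)) v (delta_mx 0 i)) &
      exists C1 C2 : R,
        [/\ 0 < C1, 0 < C2 &
          forall (beta : 'I_3 -> nat) (v : 'rV[R]_3), (mdegree beta <= 1)%N ->
            `|multi_derive beta (fun w => lambda1 k0 (euclidean_norm w)) v|
              <= C1 * ln (2 + euclidean_norm v)
                    * (1 + euclidean_norm v) ^- (3 + mdegree beta)
            /\
            `|multi_derive beta (fun w => lambda2 k0 (euclidean_norm w)) v|
              <= C2 * (2 + euclidean_norm v) ^- (1 + mdegree beta)]].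
Proof.
pose g := gauss_J k0.
have cg : continuous g by exact: continuous_gauss_J.
have g0 x : 0 <= g x by exact: gauss_J_ge0.
pose s : R := Num.sqrt (2 * pi); pose L : R := 2 * s.
have pi0 := pi_gt0 R.
have s0 : 0 < s by rewrite sqrtr_gt0 mulr_gt0.
have s2 : s ^+ 2 = 2 * pi by exact: sqr_sqrt_2pi.
have ps : pi = s ^+ 2 / 2 by rewrite s2; field.
have L0 : 0 < L by rewrite mulr_gt0.
have gL : x ^+ 3 * g x @[x --> +oo] --> L by exact: cvg_cube_gauss_J.
have [C [C0 gC]] := gauss_J_quadratic hk0.
have [G [G0 gG]] := decay_bound cg g0 L0 gL.
pose c : R := prefactor; have c0 : 0 < c by exact: prefactor_gt0.
have cE : c = pi / s by rewrite /c /prefactor mulrC.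
have l1E : lambda1 k0 = (fun r => c * moment g 2 r).
  by apply/funext => r; exact: lambda1_moment.
have l2E : lambda2 k0 = (fun r => c * ((moment g 0 r - moment g 2 r) / 2)).
  by apply/funext => r; exact: lambda2_moment.
(* c must not unfold to a product, which normrM would split *)
clearbody c.
have dm n (r : R) : 0 < r -> is_derive r 1 (moment g n) (dmoment g n r).
  by move=> r0; exact: is_derive_moment.
have dl1 (r : R) : 0 < r -> is_derive r 1 (lambda1 k0) (c * dmoment g 2 r).
  move=> r0; rewrite l1E; apply: is_derive_val (is_derive_fun_mul (is_derive_fun_cst c r) (dm 2 r r0)) _.
  by rewrite mulr0 addr0.
have dl2 (r : R) : 0 < r -> is_derive r 1 (lambda2 k0)
    (c * ((dmoment g 0 r - dmoment g 2 r) / 2)).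
  move=> r0; rewrite l2E; apply: is_derive_val (is_derive_fun_mul (is_derive_fun_cst c r)
    (is_derive_fun_mul (is_derive_fun_add (dm 0 r r0) (is_derive_fun_opp (dm 2 r r0)))
       (is_derive_fun_cst 2^-1 r))) _.
  by move: (dmoment _ _ _) (dmoment _ _ _) => a b; rewrite /=; field.
have mq n (r : R) : 0 <= r <= 2^-1 -> `|moment g n r - moment g n 0| <= C * r ^+ 2.
  by move=> hr; exact: moment_quadratic.
have q1 r : 0 <= r <= 2^-1 -> `|lambda1 k0 r - lambda1 k0 0| <= c * C * r ^+ 2.
  move=> hr; rewrite l1E -mulrBr normrM (ger0_norm (ltW c0)) -mulrA.
  by apply: ler_wpM2l; [exact: ltW|exact: mq].
have q2 r : 0 <= r <= 2^-1 -> `|lambda2 k0 r - lambda2 k0 0| <= c * C * r ^+ 2.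
  move=> hr; rewrite l2E -mulrBr normrM (ger0_norm (ltW c0)) -mulrA.
  apply: ler_wpM2l; first exact: ltW.
  have h0 := mq 0%N r hr; have h2 := mq 2%N r hr.
  rewrite (_ : _ - _ = ((moment g 0 r - moment g 0 0) - (moment g 2 r - moment g 2 0)) / 2).
    rewrite normrM [`|2^-1|]ger0_norm// ler_pdivrMr//.
    by apply: le_trans (ler_normB _ _) _; move: h0 h2; move: `|_| `|_| => a b; lra.
  by move: (moment g 0 r) (moment g 0 0) (moment g 2 r) (moment g 2 0) => a b d e; field.
(* d1 and d2 are the radial derivatives, extended by 0 to the origin *)
pose d1 r := if r == 0 then 0 else c * dmoment g 2 r.
pose d2 r := if r == 0 then 0 else c * ((dmoment g 0 r - dmoment g 2 r) / 2).
have D1 (i : 'I_3) (v : 'rV[R]_3) : is_derive v (delta_mx 0 i)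
    (fun w => lambda1 k0 (euclidean_norm w)) (d1 (euclidean_norm v) * (v 0 i / euclidean_norm v)).
  rewrite /d1; have [v0|v0] := eqVneq (euclidean_norm v) 0.
    by rewrite mul0r; exact: is_derive_radial0 v0 q1.
  by apply: is_derive_radial; [|apply: dl1]; rewrite lt0r v0 euclidean_norm_ge0.
have D2 (i : 'I_3) (v : 'rV[R]_3) : is_derive v (delta_mx 0 i)
    (fun w => lambda2 k0 (euclidean_norm w)) (d2 (euclidean_norm v) * (v 0 i / euclidean_norm v)).
  rewrite /d2; have [v0|v0] := eqVneq (euclidean_norm v) 0.
    by rewrite mul0r; exact: is_derive_radial0 v0 q2.
  by apply: is_derive_radial; [|apply: dl2]; rewrite lt0r v0 euclidean_norm_ge0.
have ratio1 (i : 'I_3) (v : 'rV[R]_3) : `|v 0 i / euclidean_norm v| <= 1.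
  have [v0|v0] := eqVneq (euclidean_norm v) 0; first by rewrite v0 invr0 mulr0 normr0.
  have vp : 0 < euclidean_norm v by rewrite lt0r v0 euclidean_norm_ge0.
  by rewrite normrM normfV (ger0_norm (ltW vp)) ler_pdivrMr// mul1r euclidean_norm_coord.
split.
- have h : c / (2 * pi) * (moment g 2 r * ((1 + r ^+ 3) / ln (2 + r))) @[r --> +oo] --> (1 : R).
    rewrite -[X in _ --> X](_ : c / (2 * pi) * L = 1).
      by apply: cvgM; [exact: cvg_cst|exact: (cvg_moment2 cg gL)].
    by rewrite cE /L ps; field; rewrite gt_eqF.
  apply: cvg_trans h; apply: near_eq_cvg; near=> r.
  have r1 : 1 <= r by near: r; exact: near_pinfty_ge.
  have r0 : 0 <= r by lra.
  have r3 : 0 < 1 + r ^+ 3 by have := exprn_ge0 3 r0; lra.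
  have := ln2_ge_half r0; rewrite l1E.
  move: (ln _) (moment _ _ _) (1 + _) r3 => l m z z0 l0.
  by field; rewrite !gt_eqF//; lra.
- set I := \int[_]_(y in _) _.
  have I0 : 0 < I by exact: (integral_halfline_gt0 cg g0 L0 gL G0 gG).
  have sE : Num.sqrt (pi / 8) = s / 4.
    rewrite (_ : pi / 8 = 2 * pi * (4^-1) ^+ 2); last by field.
    by rewrite sqrtrM ?mulr_ge0 ?(ltW pi0)// sqrtr_sqr ger0_norm// invr_ge0.
  have h : c / (s / 4 * I) * ((1 + r) * ((moment g 0 r - moment g 2 r) / 2)) @[r --> +oo] --> (1 : R).
    rewrite -[X in _ --> X](_ : c / (s / 4 * I) * (I / 2) = 1).
      by apply: cvgM; [exact: cvg_cst|exact: (cvg_moment_diff cg g0 G0 gG)].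
    by rewrite cE ps; move: I I0 => J J0; field; rewrite !gt_eqF.
  apply: cvg_trans h; apply: near_eq_cvg; near=> r.
  have r1 : 1 <= r by near: r; exact: near_pinfty_ge.
  rewrite l2E sE.
  move: I I0 (moment _ _ _) (moment _ _ _) => J J0 a b.
  by field; rewrite !gt_eqF//; lra.
- by move=> i v; split; [case: (D1 i v)|case: (D2 i v)].
exists (c * (16 * G + (150 * G + 128 * C))).
exists (c * (3 * G + (25 * G + 18 * C) + 4 * (150 * G + 128 * C))).
split; [by apply: mulr_gt0 => //; lra|by apply: mulr_gt0 => //; lra|].
move=> beta v hb; set r := euclidean_norm v.
have r0 : 0 <= r by exact: euclidean_norm_ge0.
have lr := ln2_ge_half r0.
have r10 : 0 < 1 + r by lra.
have r20 : 0 < 2 + r by lra.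
have [[-> E]|[-> [i E]]] := @multi_derive_order_le1 R beta hb.
  rewrite !E !addn0 l1E l2E -/r !normrM (ger0_norm (ltW c0)); split.
    rewrite -!mulrA; apply: ler_wpM2l; first exact: ltW.
    rewrite ger0_norm; last exact: moment_ge0.
    apply: (le_trans (moment2_bound cg g0 G0 gG r0)).
    rewrite -mulrA; apply: ler_wpM2r; last lra.
    by rewrite mulr_ge0// ?invr_ge0 ?exprn_ge0 ?(ltW r10)//; lra.
  rewrite expr1 -mulrA; apply: ler_wpM2l; first exact: ltW.
  rewrite -normrM ger0_norm; last by rewrite divr_ge0// subr_ge0 moment_anti.
  apply: (@le_trans _ _ (moment g 0 r)).
    have := moment_ge0 g0 2 r; have := moment_ge0 g0 0 r.
    by move: (moment _ _ _) (moment _ _ _) => a b; lra.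
  apply: (le_trans (moment0_bound cg g0 G0 gG r0)).
  by apply: ler_wpM2r; [rewrite invr_ge0 ltW|lra].
have b1 : `|d1 r| <= c * (150 * G + 128 * C) * ln (2 + r) * (1 + r) ^- 4.
  rewrite /d1; have [_|rn0] := eqVneq r 0.
    by rewrite normr0 !mulr_ge0 ?(ltW c0) ?invr_ge0 ?exprn_ge0 ?(ltW r10)//; lra.
  have rp : 0 < r by rewrite lt0r rn0.
  rewrite normrM (ger0_norm (ltW c0)) -!mulrA; apply: ler_wpM2l; first exact: ltW.
  by rewrite mulrA; exact: (dmoment2_bound cg g0 C0 gC G0 gG rp).
have b2 : `|d2 r| <= c * (25 * G + 18 * C + 4 * (150 * G + 128 * C)) * (2 + r) ^- 2.
  rewrite /d2; have [_|rn0] := eqVneq r 0.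
    by rewrite normr0 !mulr_ge0 ?(ltW c0) ?invr_ge0 ?exprn_ge0 ?(ltW r20)//; lra.
  have rp : 0 < r by rewrite lt0r rn0.
  rewrite normrM (ger0_norm (ltW c0)) -!mulrA; apply: ler_wpM2l; first exact: ltW.
  rewrite normrM [`|2^-1|]ger0_norm// ler_pdivrMr// mulrDl.
  have h0 := dmoment0_bound cg g0 C0 gC G0 gG rp.
  have h2 := dmoment20_bound cg g0 C0 gC G0 gG rp.
  apply: le_trans (ler_normB _ _) _.
  have := normr_ge0 (dmoment g 0 r); have := normr_ge0 (dmoment g 2 r).
  by move: h0 h2; move: `|_| `|_| (_ * _) (_ * _) => x y z w; lra.
rewrite !E (derive_val (is_derive := D1 i v)) (derive_val (is_derive := D2 i v)) -/r.
rewrite !addn1/= !normrM -!normrM; split.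
  rewrite normrM; apply: (@le_trans _ _ (`|d1 r| * 1)); first by apply: ler_wpM2l.
  rewrite mulr1; apply: (le_trans b1).
  rewrite -2!mulrA -[leRHS]mulrA -[leRHS]mulrA; apply: ler_wpM2l; first exact: ltW.
  apply: ler_wpM2r; last lra.
  by rewrite mulr_ge0// ?invr_ge0 ?exprn_ge0 ?(ltW r10)//; lra.
rewrite normrM; apply: (@le_trans _ _ (`|d2 r| * 1)); first by apply: ler_wpM2l.
rewrite mulr1; apply: (le_trans b2).
apply: ler_wpM2r; first by rewrite invr_ge0 exprn_ge0 ?(ltW r20).
by apply: ler_wpM2l; [exact: ltW|lra].
Unshelve. all: by end_near.
Qed.
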